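(* Let $A\in\mathbb{Z}^{m\times n}$ have full column rank, let $b\in\mathbb{Z}^m$ and $\alpha\in\mathbb{Z}^n$, and suppose that $\{x\in\mathbb{R}^n: Ax\le b\}\cap\mathbb{Z}^n=\{\mathbf{0}\}$. Let $\kappa_d=\kappa_d(A,b,\alpha)$ be the numbers defined in the context. Then $$\kappa_1<1,\qquad \kappa_2<1,\qquad \kappa_3<\sqrt{2}.$$ (Equivalently: for every $I\subseteq[m]$ indexing linearly independent rows of $A$ with $|I|\le n-1$, one has $\kappa_I(A,b,\alpha)<1$ if $\dim\mathcal{P}_I(A,b)\in\{1,2\}$, and $\kappa_I(A,b,\alpha)<\sqrt2$ if $\dim\mathcal{P}_I(A,b)=3$.)
   Context: Notation: $[m]=\{1,\dots,m\}$; for $I\subseteq[m]$, $A_I$ is the submatrix of $A$ formed by the rows indexed by $I$. $\mathcal{P}(A,b):=\{x\in\mathbb{R}^n: Ax\le b\}$. For $I\subseteq[m]$ with $|I|\le n-1$, $\mathcal{P}_I(A,b):=\mathcal{P}(A,b)\cap\ker A_I$, with $\mathcal{P}_\emptyset(A,b):=\mathcal{P}(A,b)$. $\gcd A_I$ is the greatest common divisor of the numbers $|\det M|$ where $M$ ranges over the $\operatorname{rank}(A_I)\times\operatorname{rank}(A_I)$ submatrices of $A_I$ (so $\gcd A_\emptyset=1$). Define $$\Delta_I(A,\alpha):=\frac{1}{\gcd A_I}\max\left\{\left|\det\begin{pmatrix}\alpha^\top\\ A_K\end{pmatrix}\right| : I\subseteq K\subseteq[m],\ |K|=n-1\right\}.$$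 For $I$ indexing linearly independent rows of $A$ with $|I|\le n-1$, $\kappa_I(A,b,\alpha)$ is the number satisfying $$\max_{x\in\mathcal{P}_I(A,b)}\alpha^\top x=\kappa_I(A,b,\alpha)\,\Delta_I(A,\alpha),$$ with the convention $\kappa_I(A,b,\alpha):=0$ if $\Delta_I(A,\alpha)=0$ (in which case the maximum is $0$). Finally $$\kappa_d(A,b,\alpha):=\max\{\kappa_I(A,b,\alpha): I\subseteq[m] \text{ indexes linearly independent rows of } A,\ |I|\le n-1,\ \dim\mathcal{P}_I(A,b)=d\},$$ and a bound on $\kappa_d$ is regarded as vacuously true if there is no such $I$. *)

(* Defs.v *)
From HB Require Import structures.
From mathcomp Require Import all_boot all_order all_algebra.
From mathcomp Require Import all_classical all_reals ereal.

Set Implicit Arguments.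
Unset Strict Implicit.
Unset Printing Implicit Defensive.

Import Order.TTheory GRing.Theory Num.Theory.

Local Open Scope classical_set_scope.
Local Open Scope ring_scope.

(* [m] is 'I_m, and A_I lists the rows of A indexed by I in increasing order. *)
Definition rows (T : Type) (m n : nat) (A : 'M[T]_(m, n)) (I : {set 'I_m}) :
  'M[T]_(#|I|, n) := rowsub (fun k : 'I_#|I| => enum_val k) A.

Definition int_rank (m n : nat) (A : 'M[int]_(m, n)) : nat :=
  \rank (map_mx intr A : 'M[rat]_(m, n)).

Definition lin_indep_rows (m n : nat) (A : 'M[int]_(m, n)) (I : {set 'I_m}) :
  bool := row_free (map_mx intr (rows A I) : 'M[rat]_(#|I|, n)).

(* In [abs_minor] and [max_minor] below, conform_mx only identifies a matrix
   type with the square type of propositionally equal dimensions: the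
   conditions on the index sets guarantee that its default value 0 is never
   returned. *)
Definition abs_minor (p n r : nat) (B : 'M[int]_(p, n))
    (J : {set 'I_p}) (L : {set 'I_n}) : nat :=
  absz (\det (conform_mx (0 : 'M_r)
    (mxsub (fun k : 'I_#|J| => enum_val k) (fun l : 'I_#|L| => enum_val l) B))).

(* For a matrix with no rows, the only minor is the 0 x 0 one, of value 1. *)
Definition gcd_minors (p n : nat) (B : 'M[int]_(p, n)) : nat :=
  \big[gcdn/0%N]_(J : {set 'I_p} | #|J| == int_rank B)
    \big[gcdn/0%N]_(L : {set 'I_n} | #|L| == int_rank B)
      abs_minor (int_rank B) B J L.

Definition max_minor (m n : nat) (A : 'M[int]_(m, n)) (alpha : 'cV[int]_n)
    (I : {set 'I_m}) : nat :=
  (\max_(K : {set 'I_m} | (I \subset K) && (#|K|.+1 == n))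
     absz (\det (conform_mx (0 : 'M_n) (col_mx alpha^T (rows A K)))))%N.

Definition Delta (R : realType) (m n : nat) (A : 'M[int]_(m, n))
    (alpha : 'cV[int]_n) (I : {set 'I_m}) : R :=
  (max_minor A alpha I)%:R / (gcd_minors (rows A I))%:R.

Definition polyhedron (R : realType) (m n : nat) (A : 'M[int]_(m, n))
    (b : 'cV[int]_m) : set 'cV[R]_n :=
  [set x | forall i, (map_mx intr A *m x) i 0 <= (b i 0)%:~R].

Arguments polyhedron R {m n} A b.

Definition polyhedron_section (R : realType) (m n : nat) (A : 'M[int]_(m, n))
    (b : 'cV[int]_m) (I : {set 'I_m}) : set 'cV[R]_n :=
  polyhedron R A b `&` [set x | map_mx intr (rows A I) *m x = 0].

Definition int_points (R : realType) (n : nat) : set 'cV[R]_n :=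
  range (fun z : 'cV[int]_n => map_mx intr z).

Arguments polyhedron_section R {m n} A b I.
Arguments int_points R n : clear implicits.

Definition affine_hull (R : realType) (n : nat) (S : set 'cV[R]_n) :
    set 'cV[R]_n :=
  [set x | exists (k : nat) (p : 'I_k -> 'cV[R]_n) (c : 'I_k -> R),
     [/\ forall i, S (p i), \sum_i c i = 1 & x = \sum_i c i *: p i]].

(* dim S = d: the affine hull of S is a translate of a linear subspace of
   dimension d. *)
Definition has_dim (R : realType) (n : nat) (S : set 'cV[R]_n) (d : nat) :
    Prop :=
  exists (x0 : 'cV[R]_n) (V : {vspace 'cV[R]_n}),
    \dim V = d /\ affine_hull S = [set x0 + v | v in [set` V]].

(* The maxima defining kappa_I and kappa_d are suprema in the extended reals,
   so that an unbounded objective has value +oo and the maximum over no I is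
   -oo (any upper bound on kappa_d is then vacuously true). *)
Definition kappa (R : realType) (m n : nat) (A : 'M[int]_(m, n))
    (b : 'cV[int]_m) (alpha : 'cV[int]_n) (I : {set 'I_m}) : \bar R :=
  if Delta R A alpha I == 0 then 0%E
  else (ereal_sup [set (((map_mx intr alpha)^T *m x) 0 0)%:E
                  | x in polyhedron_section R A b I]
        * ((Delta R A alpha I)^-1)%:E)%E.

Definition kappa_dim (R : realType) (m n : nat) (A : 'M[int]_(m, n))
    (b : 'cV[int]_m) (alpha : 'cV[int]_n) (d : nat) : \bar R :=
  ereal_sup [set kappa R A b alpha I
            | I in [set I : {set 'I_m} |
                    [/\ lin_indep_rows A I, (#|I| < n)%N
                      & has_dim (polyhedron_section R A b I) d]]].

(* Main.v *)
(* Symmetrizing. If x lies in P, z is a nonzero integer vector, |t| <= 1 and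
   |A_k (z - t x)| < 1 for all k, then integrality and 0 <= b put z or -z in P,
   a contradiction. So the symmetric prism [-x, x] + C, where C is the section
   by alpha = 0 of {|A_k u| < 1 for all k}, has no nonzero lattice point, and
   its volume is at most 2^d by pigeonhole.

   Take alpha and the d - 1 rows A_k maximizing the determinant with alpha as
   coordinates; the lattice then has index D in Z^d, where D is this maximum.
   For d = 1, C is a point, and for d = 2, C = (-1, 1), so alpha x < D. For
   d = 3, the rows become points (a_k, b_k) with pairwise determinants at most 1
   in absolute value, including (1, 0) and (0, 1), and C is the interior of
   {(u, v) : |a_k u + b_k v| <= 1 for all k}. With s1 = max |a_k + b_k| and
   s2 = max |a_k - b_k|, this set contains (1/s1, 1/s1) and (-1/s2, 1/s2), and
   also the quarter turns of the points attaining s1 and s2. With (1, 0), (0, 1)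
   and the opposite points, the two pairs span octagons of area 2/s1 + 2/s2 and
   s1 + s2, one of which is at least 2 sqrt 2. This gives alpha x < sqrt 2 D.

   A section of dimension d is the full kernel of some n - d independent rows
   extending A_I, and a basis of the lattice of integer points of this kernel,
   obtained from the Smith normal form, reduces to the case n = d. Applied to
   +-e_i the bound shows that the section is compact, so the maximum is attained
   and the strict inequality survives. *)

Require Import Defs.
From HB Require Import structures.
From mathcomp Require Import all_boot all_order all_algebra perm.
From mathcomp Require Import all_classical all_reals ereal.
From mathcomp Require Import topology normedtype derive.
From mathcomp Require Import zify ring lra.

Set Implicit Arguments.
Unset Strict Implicit.
Unset Printing Implicit Defensive.

Import Order.TTheory GRing.Theory Num.Theory.
Import numFieldNormedType.Exports.

Local Open Scope ring_scope.

(** * Integer matrices *)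

Lemma absz_prod (I : finType) (F : I -> int) :
  absz (\prod_i F i) = (\prod_i absz (F i))%N.
Proof. by apply: (big_morph absz) => // a b; rewrite abszM. Qed.

Lemma absz_det_unitmx n (X : 'M[int]_n) : X \in unitmx -> absz (\det X) = 1%N.
Proof. by rewrite unitmxE => /orP[] /eqP ->. Qed.

Lemma det_rowsub_injective n m (Q : 'M[int]_(m, n)) (g : 'I_n -> 'I_m) :
  \det (rowsub g Q) != 0 -> injective g.
Proof.
move=> dN0 i j gij; apply/eqP; apply: contraNT dN0 => /determinant_alternate.
by move=> /(_ _ (rowsub g Q)) ->// k; rewrite !mxE gij.
Qed.

(** The selection [g] is [g'] after a permutation, which only changes the sign of the
    determinant. *)
Lemma absz_det_rowsub_image n m (Q : 'M[int]_(m, n)) (g g' : 'I_n -> 'I_m) :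
  injective g -> (forall i, exists j, g i = g' j) ->
  absz (\det (rowsub g Q)) = absz (\det (rowsub g' Q)).
Proof.
move=> ginj /fin_all_exists[s gs].
have sinj : injective s by move=> i j sij; apply: ginj; rewrite !gs sij.
have -> : rowsub g Q = row_perm (perm sinj) (rowsub g' Q).
  by apply/matrixP => i j; rewrite !mxE permE gs.
by rewrite row_permE det_mulmx det_perm abszM absz_sign mul1n.
Qed.

Lemma absz_det_colsub_image n m (Q : 'M[int]_(n, m)) (g g' : 'I_n -> 'I_m) :
  injective g -> (forall i, exists j, g i = g' j) ->
  absz (\det (colsub g Q)) = absz (\det (colsub g' Q)).
Proof.
move=> ginj gg'; rewrite -det_tr -[in RHS]det_tr !trmx_mxsub.
exact: absz_det_rowsub_image.
Qed.

Lemma Smith_square d (H : 'M[int]_d) : exists (L X : 'M[int]_d) (D : 'rV[int]_d),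
  [/\ L \in unitmx, X \in unitmx, H = L *m diag_mx D *m X
    & absz (\det H) = (\prod_i absz (D 0%R i))%N].
Proof.
have [L uL [X uX [s _ ->]]] := int_Smith_normal_form H.
have DE : \matrix_(i, j) (s`_i *+ (i == j :> nat)) = diag_mx (\row_i s`_i) :> 'M_d.
  by apply/matrixP => i j; rewrite !mxE.
exists L, X, (\row_i s`_i); split => //; first by rewrite DE.
rewrite !det_mulmx !abszM (absz_det_unitmx uL) (absz_det_unitmx uX) mul1n muln1.
rewrite DE det_diag absz_prod.
by apply: eq_bigr => i _; rewrite mxE.
Qed.

(** In the coordinates given by [invmx L], the quotient of Z^d by the image of [H] is a product of
    cyclic groups of orders |D_i|, so it has |det H| elements. *)
Lemma lattice_pigeonhole d (H : 'M[int]_d) (F : finType) (f : F -> 'cV[int]_d) :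
  \det H != 0 -> (absz (\det H) < #|F|)%N ->
  exists x y, x != y /\ exists z, f x - f y = H *m z.
Proof.
have [L [X [D [uL uX HE detE]]]] := Smith_square H.
rewrite -absz_gt0 detE => prod_gt0 ltF.
have D_gt0 i : (0 < absz (D 0%R i))%N.
  rewrite lt0n; apply: contraTneq prod_gt0 => Di0.
  by rewrite (bigD1 i)//= Di0 mul0n.
pose c x i := (((invmx L *m f x) i 0%R) %% D 0%R i)%Z.
have c_lt x i : (absz (c x i) < absz (D 0%R i))%N.
  have D0 : D 0%R i != 0 by rewrite -absz_gt0.
  by have := modz_ge0 ((invmx L *m f x) i 0%R) D0;
     have := ltz_mod ((invmx L *m f x) i 0%R) D0; rewrite -/(c x i); lia.
pose cl x : {dffun forall i : 'I_d, 'I_(absz (D 0%R i))} :=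
  [ffun i => Ordinal (c_lt x i)].
have /injectivePn[x [y xy clxy]] : ~~ injectiveb cl.
  apply: contraL ltF => /injectiveP /leq_card.
  rewrite card_dep_ffun /= -leqNgt => /leq_trans; apply.
  rewrite foldrE big_image /=.
  by under eq_bigr do rewrite card_ord.
exists x, y; split=> //.
(* Equal residues leave only [D] times the difference of the quotients; [invmx X] undoes the last
   factor of the Smith form. *)
exists (invmx X *m \col_i (((invmx L *m f x) i 0%R %/ D 0%R i)%Z
                         - ((invmx L *m f y) i 0%R %/ D 0%R i)%Z)).
rewrite HE -!mulmxA mulKVmx//; apply: (can_inj (mulKVmx uL)).
rewrite mulKmx// mulmxBr; apply/matrixP => i j; rewrite ord1 mul_diag_mx !mxE.
have cE : c x i = c y i.
  have : val (cl x i) = val (cl y i) by rewrite clxy.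
  rewrite !ffunE /=.
  have D0 : D 0%R i != 0 by rewrite -absz_gt0.
  by have := modz_ge0 ((invmx L *m f x) i 0%R) D0;
     have := modz_ge0 ((invmx L *m f y) i 0%R) D0; rewrite -/(c x i) -/(c y i); lia.
move: cE; rewrite /c !mxE => cE.
rewrite [in LHS](divz_eq (\sum_j invmx L i j * f x j 0) (D 0%R i)).
rewrite [X in _ - X](divz_eq (\sum_j invmx L i j * f y j 0) (D 0%R i)) cE.
by ring.
Qed.

(** When [T] is nonsingular, the last [d] columns of the unimodular [X] form a basis of the lattice
    of integer points in the kernel of [M]. *)
Lemma kernel_basis r d (M : 'M[int]_(r, r + d)) :
  exists (X : 'M[int]_(r + d)) (T : 'M[int]_r),
    X \in unitmx /\ M *m X = row_mx T 0.
Proof.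
have [L uL [X uX [s _ ME]]] := int_Smith_normal_form M.
exists (invmx X), (L *m \matrix_(i, j) (s`_i *+ (i == j :> nat))).
split; first by rewrite unitmx_inv.
rewrite {1}ME mulmxK//.
have -> : \matrix_(i, j) (s`_i *+ (i == j :> nat)) =
   row_mx (\matrix_(i, j) (s`_i *+ (i == j :> nat))) 0 :> 'M_(r, r + d).
  apply/matrixP => i j; rewrite !mxE; case: splitP => k -> ; rewrite !mxE//.
  by rewrite ltn_eqF ?mulr0n// ltn_addr.
by rewrite mul_mx_row mulmx0.
Qed.

Lemma det_mulmx_dvd r n (M : 'M[int]_(r, n)) (Y : 'M[int]_(n, r)) (g : nat) :
  (forall f : 'I_r -> 'I_n, injective f -> (g %| absz (\det (colsub f M)))%N) ->
  (g %| absz (\det (M *m Y)))%N.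
Proof.
move=> gM.
(* Cauchy-Binet without regrouping the injections with the same image. *)
have -> : \det (M *m Y) = \sum_(f : {ffun 'I_r -> 'I_n})
    (\prod_i Y (f i) i) * \det (colsub f M).
  rewrite -det_tr [LHS]/determinant.
  under eq_bigr => s _.
    under eq_bigr => i _ do rewrite !mxE.
    rewrite bigA_distr_bigA/= big_distrr/=; over.
  rewrite exchange_big/=; apply: eq_bigr => f _.
  rewrite -[in RHS]det_tr /determinant big_distrr/=; apply: eq_bigr => s _.
  rewrite big_split/=.
  have -> : \prod_i (colsub f M)^T i (s i) = \prod_i M (s i) (f i).
    by apply: eq_bigr => i _; rewrite !mxE.
  by rewrite mulrA mulrC.
rewrite -[X in (X %| _)%N]/(absz g%:Z) -dvdzE; apply: rpred_sum => f _.
rewrite dvdzE abszM /=.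
have [/injectiveP finj|/injectivePn[i [j ij fij]]] := boolP (injectiveb f).
  by rewrite dvdn_mull// gM.
suff -> : \det (colsub f M) = 0 by rewrite muln0.
rewrite -det_tr; apply: (determinant_alternate ij) => k.
by rewrite !mxE fij.
Qed.

Lemma conform_mx_cast n a b (M : 'M[int]_(a, b)) (ea : n = a) (eb : n = b) :
  conform_mx (0 : 'M_n) M = mxsub (cast_ord ea) (cast_ord eb) M.
Proof.
subst a b; rewrite conform_mx_id; apply/matrixP => i j.
by rewrite !mxE !cast_ord_id.
Qed.

(** At full row rank a maximal minor uses all rows, and the columns picked by [f] are, up to order,
    one of the column sets entering the gcd. *)
Lemma gcd_minors_dvd_colsub p n (B : 'M[int]_(p, n)) (f : 'I_p -> 'I_n) :
  int_rank B = p -> injective f ->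
  (gcd_minors B %| absz (\det (colsub f B)))%N.
Proof.
move=> rkB finj; rewrite /gcd_minors rkB.
have cardJ : #|[set: 'I_p]| = p by rewrite cardsT card_ord.
have cardL : #|f @: [set: 'I_p]| = p by rewrite card_imset.
apply: (@biggcdn_inf _ [set: 'I_p]); first by rewrite cardJ.
apply: (@biggcdn_inf _ (f @: [set: 'I_p])); first by rewrite cardL.
rewrite /abs_minor (conform_mx_cast _ (esym cardJ) (esym cardL)).
set M := mxsub _ _ _; suff -> : absz (\det (colsub f B)) = absz (\det M) by [].
pose g (i : 'I_p) := enum_val (cast_ord (esym cardJ) i).
pose h (i : 'I_p) := enum_val (cast_ord (esym cardL) i).
have -> : M = rowsub g (colsub h B) by apply/matrixP => i j; rewrite !mxE.
rewrite -(@absz_det_rowsub_image _ _ _ id)//; last first.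
  move=> i; exists (cast_ord cardJ (enum_rank_in (finset.in_setT i) i)).
  by rewrite /g cast_ordK enum_rankK_in.
have -> : rowsub id (colsub h B) = colsub h B.
  by apply/matrixP => i j; rewrite !mxE.
apply: absz_det_colsub_image => // i.
have fi : f i \in f @: [set: 'I_p] by rewrite imset_f.
exists (cast_ord cardL (enum_rank_in fi (f i))).
by rewrite /h cast_ordK enum_rankK_in.
Qed.

(** A unimodular change of columns makes the product block triangular with upper left block [T],
    which is [M] times an integer matrix; Cauchy-Binet then applies to [T]. *)
Lemma gcd_minors_dvd_det p s n (M : 'M[int]_(p, n)) (M' : 'M[int]_(s, n))
    (Y : 'M[int]_(n, p + s)) :
  int_rank M = p -> (gcd_minors M %| absz (\det (col_mx M M' *m Y)))%N.
Proof.
move=> rkM; have [X [T [uX MYX]]] := kernel_basis (M *m Y).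
have -> : absz (\det (col_mx M M' *m Y)) = absz (\det (col_mx M M' *m Y *m X)).
  by rewrite [in RHS]det_mulmx abszM (absz_det_unitmx uX) muln1.
rewrite !mul_col_mx MYX -[M' *m Y *m X]hsubmxK.
rewrite -/(block_mx _ _ _ _) det_lblock abszM dvdn_mulr//.
have -> : T = M *m (Y *m lsubmx X).
  by rewrite mulmxA mulmx_lsub MYX row_mxKl.
by apply: det_mulmx_dvd => f; exact: gcd_minors_dvd_colsub.
Qed.

(** A selection with nonzero determinant repeats no row. Containing [alpha] and the rows of [I], it
    is a reordering of a matrix over which [max_minor] ranges. *)
Lemma leq_max_minor m n (A : 'M[int]_(m, n)) (alpha : 'cV[int]_n)
    (I : {set 'I_m}) (h : 'I_n -> 'I_(1 + m)) :
  (exists k, h k = lshift m 0) ->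
  (forall i, i \in I -> exists k, h k = rshift 1 i) ->
  \det (rowsub h (col_mx alpha^T A)) != 0 ->
  (absz (\det (rowsub h (col_mx alpha^T A))) <= max_minor A alpha I)%N.
Proof.
move=> [k0 hk0] hI dN0; have hinj := det_rowsub_injective dN0.
pose K := [set i | [exists k, h k == rshift 1 i]].
have imh : h @: [set: 'I_n] = lshift m 0 |: (@rshift 1 m @: K).
  apply/setP => a; apply/imsetP/setU1P => [[k _ ->]|[->|/imsetP[i]]].
  - case: (split_ordP (h k)) => j hk; rewrite hk; first by left; rewrite ord1.
    by right; rewrite imset_f// inE; apply/existsP; exists k; rewrite hk.
  - by exists k0.
  - by rewrite inE => /existsP[k /eqP hk] ->; exists k.
have cardK : n = (1 + #|K|)%N.
  have := congr1 (fun S : {set _} => #|S|) imh.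
  rewrite /= card_imset// cardsT card_ord cardsU1 card_imset; last exact: rshift_inj.
  suff -> : lshift m 0 \notin [set rshift 1 x | x in K] by [].
  by apply/imsetP => -[i _] /eqP; rewrite eq_lrshift.
have -> : absz (\det (rowsub h (col_mx alpha^T A))) =
          absz (\det (conform_mx (0 : 'M_n) (col_mx alpha^T (rows A K)))).
  rewrite (conform_mx_cast _ cardK (erefl n)).
  pose g (k : 'I_n) : 'I_(1 + m) := match fintype.split (cast_ord cardK k) with
    | inl _ => lshift m 0 | inr j => rshift 1 (enum_val j) end.
  transitivity (absz (\det (rowsub g (col_mx alpha^T A)))); last first.
    congr (absz (\det _)); apply/matrixP => i j.
    rewrite [LHS]mxE [RHS]mxE cast_ord_id /g.
    case: (split_ordP (cast_ord cardK i)) => k ->.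
      by rewrite !col_mxEu ord1.
    by rewrite !col_mxEd !mxE.
  apply: absz_det_rowsub_image => // k.
  case: (split_ordP (h k)) => j hk; rewrite hk.
    exists (cast_ord (esym cardK) (lshift _ 0)).
    by rewrite /g cast_ordKV (unsplitK (inl _)) ord1.
  have jK : j \in K by rewrite inE; apply/existsP; exists k; rewrite hk.
  exists (cast_ord (esym cardK) (rshift _ (enum_rank_in jK j))).
  by rewrite /g cast_ordKV (unsplitK (inr _)) enum_rankK_in.
apply: (@leq_bigmax_cond _ _ (fun K => absz (\det (conform_mx (0 : 'M_n)
   (col_mx alpha^T (rows A K)))))).
rewrite eq_sym [X in _ && (X == _)]cardK eqxx andbT.
by apply/fintype.subsetP => i /hI[k hk]; rewrite inE; apply/existsP; exists k; rewrite hk.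
Qed.

(** * Lattice points in prisms *)

(** Exchange argument: [a] is a nonzero combination of independent rows [N] of [B] and can replace
    any row with a nonzero coefficient. By Cramer's rule these coefficients are the entries of
    [a *m \adj N], up to the factor [\det N]. *)
Lemma col_mx_rowsub_det_neq0 m e (B : 'M[int]_(m, 1 + e)) (a : 'rV[int]_(1 + e)) :
  row_full (map_mx intr B : 'M[rat]_(m, 1 + e)) -> a != 0 ->
  exists f : {ffun 'I_e -> 'I_m}, \det (col_mx a (rowsub f B)) != 0.
Proof.
move=> Bfull a0; set f0 := fullrankfun Bfull.
pose N := rowsub f0 B : 'M_(1 + e).
have detN : \det N != 0.
  have := fullrowsub_unit Bfull; rewrite -map_mxsub unitmxE unitfE.
  by rewrite det_map_mx intr_eq0.
have [i ai] : exists i, (a *m \adj N) 0 i != 0.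
  apply/existsP; rewrite -negb_forall; apply: contra a0 => /forallP adj0.
  have : (a *m \adj N) *m N = 0.
    suff -> : a *m \adj N = 0 by rewrite mul0mx.
    by apply/rowP => i; rewrite [RHS]mxE; apply/eqP.
  rewrite -mulmxA mul_adj_mx mul_mx_scalar => /eqP.
  by rewrite scalemx_eq0 (negPf detN).
exists [ffun j => f0 (lift i j)].
apply: contra ai => /eqP det0; apply/eqP.
have -> : (a *m \adj N) 0 i = (-1) ^+ i *
    \det (col_mx a (rowsub [ffun j => f0 (lift i j)] B)).
  rewrite (expand_det_row _ (0 : 'I_(1 + e))) big_distrr mxE.
  apply: eq_bigr => j _; rewrite mxE /cofactor.
  have -> : col_mx a (rowsub [ffun j => f0 (lift i j)] B) 0 j = a 0 j.
    by have -> : 0 = lshift e 0 :> 'I_(1 + e); [exact: val_inj|rewrite col_mxEu].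
  have -> : row' 0 (col' j (col_mx a (rowsub [ffun j => f0 (lift i j)] B))) =
            row' i (col' j N).
    apply/matrixP => k l; rewrite !mxE.
    have -> : lift 0 k = rshift 1 k :> 'I_(1 + e) by apply: val_inj.
    by rewrite (unsplitK (inr _)) !mxE ffunE.
  have -> : ((0%R : 'I_(1 + e)) + j = j)%N by [].
  by rewrite exprD -!mulrA mulrCA.
by rewrite det0 mulr0.
Qed.

Lemma map_intr_subZE (R : pzRingType) m n (v : 'M[int]_(m, n)) (w : 'M[R]_(m, n))
  (t : R) i j : (map_mx intr v - t *: w) i j = (v i j)%:~R - t * w i j.
Proof. by rewrite !mxE. Qed.

(** For [t >= 0], each entry of [B *m y] is less than [t * b + 1], hence at most [b] by integrality,
    so [free] applies to [y]. For [t < 0] it applies to [- y]. *)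
Lemma near_segment_eq0 (R : realType) m d (B : 'M[int]_(m, d)) (b : 'cV[int]_m)
    (x : 'cV[R]_d) (y : 'cV[int]_d) (t : R) :
  (forall z : 'cV[int]_d, (forall k, (B *m z) k 0 <= b k 0) -> z = 0) ->
  (forall k, 0 <= b k 0) ->
  (forall k, (map_mx intr B *m x) k 0 <= (b k 0)%:~R) ->
  `|t| <= 1 ->
  (forall k, `|(map_mx intr B *m (map_mx intr y - t *: x)) k 0| < 1) ->
  y = 0.
Proof.
move=> free b_ge0 Px t1 near.
wlog t0 : t y t1 near / 0 <= t => [wlg|].
  have [t0|t0] := leP 0 t; first exact: wlg t0.
  suff /eqP : - y = 0 by rewrite oppr_eq0 => /eqP.
  apply: (wlg (- t)); rewrite ?normrN ?oppr_ge0 ?(ltW t0)// => k.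
  by rewrite map_mxN scaleNr -opprD mulmxN mxE normrN.
apply: free => k; rewrite -ltzD1 -(ltr_int R) rmorphD/=.
have /ltr_normlP[_] := near k.
rewrite mulmxBr -scalemxAr -map_mxM map_intr_subZE => near_k.
have bR : (0 : R) <= (b k 0)%:~R by rewrite ler0z.
have Pxk := Px k.
have : t * (map_mx intr B *m x) k 0 <= t * (b k 0)%:~R by rewrite ler_wpM2l.
have : t * (b k 0)%:~R <= 1 * (b k 0)%:~R.
  by rewrite ler_wpM2r// (le_trans (ler_norm _)).
by lra.
Qed.

(** Pigeonhole on a discretized prism: each layer q = 0, ..., floor h of the functional [a] carries
    a copy of the offsets, and the lattice has index |det| M^e in the grid. Two congruent points
    differ by [y]; [t] is the difference of their layers over [h], and [eps] collects the rounding
    errors. *)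
Lemma prism_point (R : realType) e (a : 'rV[int]_(1 + e)) (g : 'M[int]_(e, 1 + e))
    (x : 'cV[R]_(1 + e)) (h : R) (F : finType) (o : F -> 'cV[int]_e) (M : nat) :
  \det (col_mx a g) != 0 -> h = (map_mx intr a *m x) 0 0 -> 0 < h ->
  injective o -> (0 < M)%N ->
  (absz (\det (col_mx a g)) * M ^ e < (Num.truncn h).+1 * #|F|)%N ->
  exists (y : 'cV[int]_(1 + e)) (o1 o2 : F) (t : R) (eps : 'cV[R]_e),
    [/\ y != 0, `|t| <= 1, (map_mx intr a *m (map_mx intr y - t *: x)) = 0,
        (forall j, `|eps j 0| < 1) &
        M%:R *: (map_mx intr g *m (map_mx intr y - t *: x)) =
        map_mx intr (o o1 - o o2) + eps].
Proof.
move=> det0 hE h0 oinj M0 ltD.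
pose H := block_mx 1%:M 0 0 (M%:R)%:M *m col_mx a g.
have HE : absz (\det H) = (absz (\det (col_mx a g)) * M ^ e)%N.
  rewrite det_mulmx det_lblock det1 det_scalar mul1r abszM abszX mulnC.
  by rewrite natz.
pose s q j : R := M%:R * q%:R * (map_mx intr g *m x) j 0 / h.
(* The points on the layer [q] are translated by [q / h *: x], rounded to the
   grid of mesh [1 / M]. *)
pose p (u : 'I_(Num.truncn h).+1 * F) : 'cV[int]_(1 + e) :=
  col_mx (u.1 : nat)%:Z%:M (\col_j Num.floor (s u.1 j) + o u.2).
have [||[q1 o1] [[q2 o2] [qo12 [y yE]]]] := @lattice_pigeonhole _ H _ p.
- by rewrite -absz_gt0 HE muln_gt0 absz_gt0 det0 expn_gt0 M0.
- by rewrite HE card_prod card_ord.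
have {yE} : col_mx (q1%:Z - q2%:Z)%:M (\col_j Num.floor (s q1 j) -
      \col_j Num.floor (s q2 j) + (o o1 - o o2)) =
    col_mx (a *m y) (M%:R *: (g *m y)).
  have <- : H *m y = col_mx (a *m y) (M%:R *: (g *m y)).
    rewrite /H -mulmxA [col_mx a g *m y]mul_col_mx mul_block_col mul1mx mul0mx addr0 mul0mx add0r.
    by rewrite mul_scalar_mx.
  rewrite -yE /p opp_col_mx add_col_mx /= raddfB /=.
  by congr (col_mx _ _); rewrite opprD addrACA.
move=> /eq_col_mx[ay gy].
exists y, o1, o2, ((q1%:R - q2%:R) / h),
  (\col_j ((Num.floor (s q1 j))%:~R - s q1 j - ((Num.floor (s q2 j))%:~R - s q2 j))).
have leh (q : 'I_(Num.truncn h).+1) : 0 <= q%:R :> R /\ q%:R <= h.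
  split; first exact: ler0n.
  apply: (@le_trans _ _ (Num.truncn h)%:R); first by rewrite ler_nat -ltnS.
  by have /andP[] := truncn_itv (ltW h0).
have ayR : map_mx intr a *m map_mx intr y = (q1%:R - q2%:R : R)%:M.
  rewrite -map_mxM -ay map_scalar_mx/= rmorphB/=.
  by rewrite !pmulrn.
split.
(* If [y = 0], the layers agree, hence so do the translations, and injectivity of [o] identifies the
   two points. *)
- apply: contra_neq qo12 => y0; move: ay gy; rewrite y0 !mulmx0 scaler0.
  move=> /(congr1 (fun A : 'M_1 => A 0 0)); rewrite !mxE /= mulr1n => q12.
  have {q12} q12 : q1 = q2 by apply: val_inj => /=; lia.
  rewrite q12 subrr add0r => /eqP; rewrite subr_eq0 => /eqP /oinj.
  by move=> ->.
- rewrite normrM normfV [X in _ / X]gtr0_norm// ler_pdivrMr// mul1r ler_norml.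
  by have := leh q1; have := leh q2; lra.
- rewrite mulmxBr -scalemxAr ayR.
  by rewrite [_ *m x]mx11_scalar -hE scale_scalar_mx divfK ?subrr// gt_eqF.
- move=> j; rewrite mxE ltr_norml.
  have /andP[f1 f2] := floor_itv (s q1 j).
  have /andP[f3 f4] := floor_itv (s q2 j).
  by move: f2 f4; rewrite !intrD; lra.
apply/matrixP => j k; rewrite ord1 mulmxBr -scalemxAr -map_mxM.
have gyj : Num.floor (s q1 j) - Num.floor (s q2 j) + (o o1 - o o2) j 0 =
    M%:Z * (g *m y) j 0.
  by have := congr1 (fun A : 'cV[int]_e => A j 0) gy; rewrite /= !mxE natz.
have {gyj} := congr1 (fun z : int => z%:~R : R) gyj.
rewrite !(rmorphD, rmorphB, rmorphM)/=.
set u := g *m y; set w := map_mx intr g *m x => gyj.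
rewrite [LHS]mxE map_intr_subZE mulrBr -[M%:R]/(M%:Z%:~R) -gyj.
rewrite [RHS]mxE [X in _ = X + _]mxE [X in _ = _ + X]mxE /s.
by rewrite -/w; field; exact: lt0r_neq0.
Qed.

(** The rows [f] maximize the determinant with [a], and [C] holds the coordinates of the rows of [B]
    in them modulo [a]. A minor of [C] of order [e] is a quotient of two such determinants, so
    maximality bounds it by 1. *)
Lemma maximal_rows (R : realType) m e (B : 'M[int]_(m, 1 + e)) (a : 'rV[int]_(1 + e)) :
  row_full (map_mx intr B : 'M[rat]_(m, 1 + e)) -> a != 0 ->
  exists (f : 'I_e -> 'I_m) (C : 'M[R]_(m, e)),
    [/\ \det (col_mx a (rowsub f B)) != 0, rowsub f C = 1%:M,
        forall f' : 'I_e -> 'I_m, `|\det (rowsub f' C)| <= 1 &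
        forall w : 'cV[R]_(1 + e), map_mx intr a *m w = 0 ->
          map_mx intr B *m w = C *m (map_mx intr (rowsub f B) *m w)].
Proof.
move=> Bfull a0; have [f0 detf0] := col_mx_rowsub_det_neq0 Bfull a0.
pose D (f : {ffun 'I_e -> 'I_m}) := absz (\det (col_mx a (rowsub f B))).
have [f _ fmax] := @arg_maxnP _ f0 predT D erefl.
have detf : \det (col_mx a (rowsub f B)) != 0.
  by rewrite -absz_gt0 (leq_trans _ (fmax f0 erefl))// absz_gt0.
pose G : 'M[R]_(1 + e) := map_mx intr (col_mx a (rowsub f B)).
have detG : \det G = (\det (col_mx a (rowsub f B)))%:~R by rewrite det_map_mx.
have Gu : G \in unitmx by rewrite unitmxE unitfE detG intr_eq0.
pose C := map_mx intr B *m invmx G.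
have BC : map_mx intr B = C *m G by rewrite mulmxKV.
have aG : map_mx intr a = row_mx 1%:M 0 *m G.
  by rewrite /G map_col_mx mul_row_col mul1mx mul0mx addr0.
exists f, (rsubmx C); split=> //.
- have : rowsub f C = row_mx 0 1%:M.
    apply: (can_inj (mulmxK Gu)); rewrite mul_rowsub_mx -BC.
    by rewrite /G map_col_mx mul_row_col mul0mx mul1mx add0r map_mxsub.
  move=> /(congr1 rsubmx); rewrite row_mxKr => <-.
  by apply/matrixP => i j; rewrite !mxE.
- move=> f'; pose g : {ffun 'I_e -> 'I_m} := [ffun i => f' i].
  have detE : \det (rowsub f' (rsubmx C)) * \det G =
      (\det (col_mx a (rowsub g B)))%:~R.
    rewrite -det_map_mx map_col_mx map_mxsub BC aG -mul_rowsub_mx -mul_col_mx.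
    rewrite det_mulmx -[rowsub g C]hsubmxK -/(block_mx _ _ _ _) det_lblock det1 mul1r.
    congr (\det _ * _); apply/matrixP => i j; rewrite !mxE ffunE//.
  have G0 : 0 < `|\det G| by rewrite normr_gt0 detG intr_eq0.
  rewrite -(ler_pM2r G0) -normrM detE detG mul1r -!intr_norm ler_int.
  by have : (D g <= D f)%N := fmax g erefl; rewrite /D -lez_nat !abszE.
move=> w aw; rewrite {1}BC -mulmxA -[C in LHS]hsubmxK.
by rewrite /G map_col_mx mul_col_mx aw mul_row_col mulmx0 add0r.
Qed.

(* The full-dimensional case, in dimension d = 1 + e. *)
Definition facet_det_bound (R : realType) (e : nat) (kap : R) : Prop :=
  forall m (B : 'M[int]_(m, 1 + e)) (b : 'cV[int]_m) (a : 'rV[int]_(1 + e))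
    (x : 'cV[R]_(1 + e)),
  row_full (map_mx intr B : 'M[rat]_(m, 1 + e)) ->
  (forall z : 'cV[int]_(1 + e), (forall k, (B *m z) k 0 <= b k 0) -> z = 0) ->
  (forall k, 0 <= b k 0) -> a != 0 ->
  (forall k, (map_mx intr B *m x) k 0 <= (b k 0)%:~R) ->
  exists f : 'I_e -> 'I_m, \det (col_mx a (rowsub f B)) != 0 /\
    (map_mx intr a *m x) 0 0 < kap * (absz (\det (col_mx a (rowsub f B))))%:R.

(* The points [o u / M] discretize one half of the section C; [D] is the index
   of the lattice in the coordinates given by [a] and the rows of [f], and [N]
   is the number of its layers met by the segment from 0 to x. *)
Lemma facet_det_bound_offsets (R : realType) e (kap : R) : 0 < kap ->
  (forall m (C : 'M[R]_(m, e)) (f : 'I_e -> 'I_m) (D N : nat),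
    rowsub f C = 1%:M -> (forall f' : 'I_e -> 'I_m, `|\det (rowsub f' C)| <= 1) ->
    (0 < D)%N -> kap * D%:R < N%:R ->
    exists (F : finType) (o : F -> 'cV[int]_e) (M : nat),
      [/\ injective o, (0 < M)%N, (D * M ^ e < N * #|F|)%N &
        forall o1 o2 (eps : 'cV[R]_e) k, (forall j, `|eps j 0| < 1) ->
          `|(C *m (map_mx intr (o o1 - o o2) + eps)) k 0| < M%:R]) ->
  facet_det_bound e kap.
Proof.
move=> kap0 offsets m B b a x Bfull free b_ge0 a0 Px.
have [f [C [detf fC detC CE]]] := maximal_rows R Bfull a0.
exists f; split=> //; rewrite ltNge; apply/negP.
set h := (_ *m x) 0 0; set D := absz _ => leh.
have D0 : (0 < D)%N by rewrite absz_gt0.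
have h0 : 0 < h by rewrite (lt_le_trans _ leh)// mulr_gt0// ltr0n.
(* There are floor h + 1 layers, more than [h], which makes this inequality strict. *)
have leN : kap * D%:R < (Num.truncn h).+1%:R.
  by rewrite (le_lt_trans leh)// truncnS_gt.
have [F [o [M [oinj M0 ltD small]]]] := offsets m C f D _ fC detC D0 leN.
have [y [o1 [o2 [t [eps [y0 t1 ayx eps1 gyx]]]]]] :=
  @prism_point R e a (rowsub f B) x h F o M detf erefl h0 oinj M0 ltD.
move/eqP: y0; apply; apply: (@near_segment_eq0 R m (1 + e) B b x y t free) => // k.
have := small o1 o2 eps k eps1.
rewrite -gyx -scalemxAr -CE// mxE normrM ger0_norm ?ler0n// gtr_pMr//.
by rewrite ltr0n.
Qed.

Lemma facet_det_bound0 (R : realType) : facet_det_bound 0 (1 : R).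
Proof.
apply: facet_det_bound_offsets => // m C f D N _ _ D0; rewrite mul1r ltr_nat => DN.
exists unit, (fun=> 0), 1%N; split=> //.
- by case; case.
- by rewrite card_unit muln1 exp1n muln1.
move=> o1 o2 eps k _.
by rewrite mxE big_ord0 normr0.
Qed.

(** One offset suffices: the rounding error stays in (-1, 1), and multiplying it by an entry of [C],
    at most 1 in absolute value, keeps it there. *)
Lemma facet_det_bound1 (R : realType) : facet_det_bound 1 (1 : R).
Proof.
apply: facet_det_bound_offsets => // m C f D N _ detC D0; rewrite mul1r ltr_nat => DN.
exists unit, (fun=> 0), 1%N; split=> //.
- by case; case.
- by rewrite card_unit muln1 exp1n muln1.
move=> o1 o2 eps k eps1.
rewrite mxE big_ord1 subrr !mxE add0r normrM.
have := detC (fun=> k); rewrite det_mx11 mxE => Ck.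
by rewrite (le_lt_trans _ (eps1 0))// ler_piMl.
Qed.

(** * Dimension three *)

Lemma card_real_interval (R : realType) (M : nat) (lo up : R) :
  0 <= lo -> up <= M%:R ->
  up - lo - 1 <= #|[set j : 'I_M.+1 | (lo < j%:R) && (j%:R <= up)]|%:R.
Proof.
move=> lo0 upM; have [up0|up0] := ltP up 0.
  by rewrite (@le_trans _ _ 0)//; lra.
have /andP[lo1 lo2] := truncn_itv lo0; have /andP[up1 up2] := truncn_itv up0.
set a := Num.truncn lo in lo1 lo2; set c := Num.truncn up in up1 up2.
have cM : (c <= M)%N by rewrite -(ler_nat R); lra.
apply: (@le_trans _ _ (c - a)%N%:R).
  have [ac|/ltnW ca] := leqP a c; last first.
    move: (ca); rewrite -subn_eq0 => /eqP->.
    by move: ca; rewrite -(ler_nat R) => ca; move: up2; rewrite -natr1; lra.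
  by rewrite natrB//; move: up2; rewrite -natr1; lra.
rewrite ler_nat -[X in (X <= _)%N](card_ord (c - a)).
pose s (k : 'I_(c - a)) : 'I_M.+1 := inord (a.+1 + k).
have sE k : s k = (a.+1 + k)%N :> nat by rewrite inordK//; have := ltn_ord k; lia.
have sinj : injective s.
  by move=> k l /(congr1 val) /=; rewrite !sE => kl; apply: val_inj => /=; lia.
rewrite -cardsT -(card_imset _ sinj); apply: subset_leq_card.
apply/fintype.subsetP => _ /imsetP[k _ ->]; rewrite inE sE; apply/andP; split.
  by rewrite (lt_le_trans lo2)// ler_nat leq_addr.
by rewrite (le_trans _ up1)// ler_nat; have := ltn_ord k; lia.
Qed.

(* The integer points with positive first coordinate of the triangle with
   vertices (0, 0), (0, M), (g M, h M), except those on the side through (0, 0)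
   and (g M, h M). *)
Definition triangle_points (R : realType) (g h : R) (M : nat) :
    {set 'I_M.+1 * 'I_M.+1} :=
  [set u : 'I_M.+1 * 'I_M.+1 | [&& (0 < u.1)%N, h * u.1%:R < g * u.2%:R &
               g * u.2%:R + (1 - h) * u.1%:R <= g * M%:R]].

(** The main term is the area. The column at abscissa [i] has length M - i/g and so holds at least M
    - 1 - i/g points; summed over 1 <= i <= floor(gM), the losses are at most 3M. *)
Lemma card_triangle_points (R : realType) (g h : R) (M : nat) :
  0 <= g <= 1 -> 0 <= h <= 1 ->
  g * M%:R ^+ 2 / 2 - 3 * M%:R <= #|triangle_points g h M|%:R.
Proof.
move=> /andP[g_ge0 g1] /andP[h0 h1].
have M0 : 0 <= M%:R :> R by rewrite ler0n.
have [->|gn0] := eqVneq g 0; first by rewrite (@le_trans _ _ 0)//; nra.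
have g0 : 0 < g by rewrite lt_def gn0.
have gM0 : 0 <= g * M%:R by rewrite mulr_ge0.
have /andP[K1 K2] := truncn_itv gM0; set K := Num.truncn (g * M%:R) in K1 K2.
have KM : (K <= M)%N.
  by rewrite -(ler_nat R) (le_trans K1)// ler_piMl.
pose F (i : nat) : R := #|[set j : 'I_M.+1 | [&& (0 < i)%N, h * i%:R < g * j%:R &
               g * j%:R + (1 - h) * i%:R <= g * M%:R]]|%:R.
have -> : #|triangle_points g h M|%:R = \sum_(0 <= i < M.+1) F i.
  rewrite big_mkord -natr_sum; congr (_%:R).
  under eq_bigr do rewrite -sum1_card.
  rewrite -sum1_card pair_big_dep /=; apply: eq_bigl => -[i j].
  by rewrite !inE.
have F0 i : 0 <= F i by rewrite ler0n.
have F1 i : (0 < i <= K)%N -> M%:R - 1 - i%:R / g <= F i.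
  move=> /andP[i0 iK]; rewrite /F.
  have lo0 : 0 <= h * i%:R / g by rewrite divr_ge0 ?mulr_ge0.
  have upM : M%:R - (1 - h) * i%:R / g <= M%:R.
    by rewrite gerBl divr_ge0 ?mulr_ge0 ?subr_ge0.
  have := card_real_interval lo0 upM.
  rewrite (_ : M%:R - (1 - h) * i%:R / g - h * i%:R / g - 1 = M%:R - 1 - i%:R / g);
    last by field.
  congr (_ <= _%:R); apply: eq_card => j; rewrite !inE i0 /=.
  by rewrite ltr_pdivrMr// lerBrDr -(ler_pM2l g0) mulrDr
     (_ : g * ((1 - h) * i%:R / g) = (1 - h) * i%:R) 1?[j%:R * g]mulrC//; field.
rewrite (@big_cat_nat _ _ _ 1)//= [\sum_(1 <= i < _) F i](@big_cat_nat _ _ _ K.+1)//=.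
have sumlow : forall k, (k <= K)%N ->
   k%:R * (M%:R - 1) - k%:R * (k%:R + 1) / 2 / g <= \sum_(1 <= i < k.+1) F i.
  elim=> [|k IH] kK; first by rewrite big_geq// !mul0r subr0.
  rewrite big_nat_recr//=; apply: le_trans (lerD (IH (ltnW kK)) (F1 k.+1 _)); last first.
    by rewrite kK.
  by rewrite -natr1 le_eqVlt; apply/orP; left; apply/eqP; field.
apply: (@le_trans _ _ (\sum_(1 <= i < K.+1) F i)); last first.
  by rewrite addrCA lerDl addr_ge0// sumr_ge0.
apply: le_trans (sumlow K (leqnn K)).
have Kg : K%:R / g <= M%:R by rewrite ler_pdivrMr// mulrC.
have K0 : 0 <= K%:R :> R by rewrite ler0n.
have KMr : K%:R <= M%:R :> R by rewrite ler_nat.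
have -> : K%:R * (K%:R + 1) / 2 / g = (K%:R / g) * (K%:R + 1) / 2 by field.
have : (K%:R / g) * (K%:R + 1) <= M%:R * (g * M%:R + 1).
  by apply: ler_pM; rewrite ?divr_ge0//; lra.
have : (g * M%:R - 1) * M%:R <= K%:R * M%:R.
  by rewrite ler_wpM2r//; move: K2; rewrite -natr1; lra.
by nra.
Qed.

(** The axes are left out so that the copies placed in the four quadrants are disjoint. *)
Definition quadrant_points (R : realType) m (a b : 'I_m -> R) (M : nat) :
    {set 'I_M.+1 * 'I_M.+1} :=
  [set u : 'I_M.+1 * 'I_M.+1 | [&& (0 < u.1)%N, (0 < u.2)%N &
     [forall k, `|a k * u.1%:R + b k * u.2%:R| <= M%:R]]].

Lemma triangle_points_bound (R : realType) (a b g h : R) (M i j : nat) :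
  `|b| <= 1 -> `|a * g + b * h| <= 1 -> 0 <= h ->
  h * i%:R < g * j%:R -> g * j%:R + (1 - h) * i%:R <= g * M%:R ->
  0 < g -> `|a * i%:R + b * j%:R| <= M%:R.
Proof.
move=> b1 agbh h0 hi gj g0.
have i0 : 0 <= i%:R :> R by rewrite ler0n.
rewrite -(ler_pM2l g0) -[X in X * `|_|](gtr0_norm g0) -normrM.
have -> : g * (a * i%:R + b * j%:R) = i%:R * (a * g + b * h) + b * (g * j%:R - h * i%:R).
  by ring.
rewrite (le_trans (ler_normD _ _))// !normrM (ger0_norm i0).
rewrite [`|g * _ - _|]gtr0_norm ?subr_gt0//.
have : i%:R * `|a * g + b * h| <= i%:R * 1 by rewrite ler_wpM2l.
have : `|b| * (g * j%:R - h * i%:R) <= 1 * (g * j%:R - h * i%:R).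
  by rewrite ler_wpM2r// subr_ge0 ltW.
by lra.
Qed.

(** The diagonal to (g, h) cuts the quadrilateral (0, 0), (1, 0), (g, h), (0, 1), of area (g + h)/2,
    into two triangles. Strictness in [triangle_points] keeps the diagonal out of both, so the
    counts add up. *)
Lemma card_quadrant_points (R : realType) m (a b : 'I_m -> R) (g h : R) (M : nat) :
  0 <= g <= 1 -> 0 <= h <= 1 ->
  (forall k, `|a k| <= 1) -> (forall k, `|b k| <= 1) ->
  (forall k, `|a k * g + b k * h| <= 1) ->
  (g + h) * M%:R ^+ 2 / 2 - 6 * M%:R <= #|quadrant_points a b M|%:R.
Proof.
move=> g01 h01 a1 b1 agbh.
have := card_triangle_points M g01 h01; have := card_triangle_points M h01 g01.
set T1 := triangle_points g h M; set T2 := triangle_points h g M => cT2 cT1.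
have /andP[g0 g1] := g01; have /andP[h0 h1] := h01.
pose sw (u : 'I_M.+1 * 'I_M.+1) := (u.2, u.1).
have swinj : injective sw by move=> [? ?] [? ?] [-> ->].
have disj : [disjoint T1 & sw @: T2].
  rewrite disjoint_subset; apply/fintype.subsetP => u uT1; rewrite inE.
  apply/imsetP => -[v vT2 uv]; move: uT1 vT2; rewrite uv !inE /=.
  by move=> /and3P[_ + _] /and3P[_ + _] => /lt_trans /[apply]; rewrite ltxx.
have subQ : T1 :|: (sw @: T2) \subset quadrant_points a b M.
  apply/fintype.subsetP => -[i j]; rewrite inE => /orP[|/imsetP[[j' i'] + [-> ->]]].
    rewrite !inE /= => /and3P[i0 hi gj].
    have gj0 : 0 < g * j%:R by rewrite (le_lt_trans _ hi)// mulr_ge0.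
    have gp : 0 < g by rewrite lt_def g0 andbT; apply: contraTneq gj0 => ->; rewrite mul0r ltxx.
    rewrite i0 -(ltr_nat R) -(pmulr_rgt0 _ gp) gj0/=.
    by apply/forallP => k; exact: (@triangle_points_bound _ _ _ g h).
  rewrite !inE /= => /and3P[i0 hi gj].
  have gj0 : 0 < h * i'%:R by rewrite (le_lt_trans _ hi)// mulr_ge0.
  have gp : 0 < h by rewrite lt_def h0 andbT; apply: contraTneq gj0 => ->; rewrite mul0r ltxx.
  rewrite i0 -(ltr_nat R) -(pmulr_rgt0 _ gp) gj0/=.
  apply/forallP => k; rewrite addrC; apply: (@triangle_points_bound _ _ _ h g) => //.
  by rewrite addrC.
have := subset_leq_card subQ; rewrite cardsU disjoint_setI0// cards0 subn0.
by rewrite card_imset// -(ler_nat R) natrD; lra.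
Qed.

(** If x + y >= 1, then x >= 1 - y >= 0, and likewise for y; [t] is the common sign. *)
Lemma same_sign_norm (R : realType) (x y : R) :
  `|x| <= 1 -> `|y| <= 1 -> 1 <= `|x + y| ->
  exists t : R, [/\ `|t| = 1, `|x| = t * x, `|y| = t * y & `|x + y| = `|x| + `|y|].
Proof.
move=> x1 y1 xy1.
suff [t [tt tx ty]] : exists t : R, [/\ `|t| = 1, `|x| = t * x & `|y| = t * y].
  exists t; split=> //; rewrite tx ty -mulrDr.
  have : `|t * (x + y)| = `|x + y| by rewrite normrM tt mul1r.
  by rewrite mulrDr -tx -ty ger0_norm ?addr_ge0// mulrDr -tx -ty.
have [xy|xy] := leP 0 (x + y); rewrite ?(ger0_norm xy) ?(ltr0_norm xy) in xy1.
  by exists 1; rewrite normr1 !mul1r; move: x1 y1; rewrite !ler_norml => *;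
     split=> //; apply: ger0_norm; lra.
by exists (-1); rewrite normrN normr1 !mulN1r; move: x1 y1; rewrite !ler_norml => *;
   split=> //; apply: ler0_norm; lra.
Qed.

(** The points (g, h), (-g', h'), the unit vectors and all their opposites span an octagon of area
    (g + h) + (g' + h'). *)
Lemma octagon_vertices (R : realType) m (a b : 'I_m -> R) (k0 k1 : 'I_m) :
  a k0 = 1 -> b k0 = 0 -> a k1 = 0 -> b k1 = 1 ->
  (forall k, `|a k| <= 1) -> (forall k, `|b k| <= 1) ->
  (forall k l, `|a k * b l - b k * a l| <= 1) ->
  exists g h g' h' : R,
    [/\ [/\ 0 <= g <= 1, 0 <= h <= 1, 0 <= g' <= 1 & 0 <= h' <= 1],
        forall k, `|a k * g + b k * h| <= 1,
        forall k, `|- a k * g' + b k * h'| <= 1 &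
        2 * Num.sqrt 2 <= (g + h) + (g' + h')].
Proof.
move=> a0 b0 a1 b1 ale ble det_le.
pose s1 k := `|a k + b k|; pose s2 k := `|- a k + b k|.
have [p _ pmax] := @arg_maxP _ _ _ k0 predT s1 erefl.
have [q _ qmax] := @arg_maxP _ _ _ k0 predT s2 erefl.
have p1 : 1 <= s1 p by rewrite (le_trans _ (pmax k0 erefl))// /s1 a0 b0 addr0 normr1.
have q1 : 1 <= s2 q.
  by rewrite (le_trans _ (qmax k0 erefl))// /s2 a0 b0 addr0 normrN normr1.
have sqrt2 : 0 <= Num.sqrt 2 :> R by rewrite sqrtr_ge0.
have sqrt2E : Num.sqrt 2 ^+ 2 = 2 :> R by rewrite sqr_sqrtr.
(* By the inequality of the means, 1/s1 + 1/s2 >= sqrt 2 in the first case and s1 + s2 >= 2 sqrt 2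
   in the second. *)
have [pq|pq] := leP (s1 p * s2 q) 2.
  have inv1 (s : R) : 1 <= s -> 0 <= s^-1 <= 1.
    by move=> s1'; have s0 := lt_le_trans ltr01 s1'; rewrite invr_ge0 (ltW s0) /= invf_le1.
  exists (s1 p)^-1, (s1 p)^-1, (s2 q)^-1, (s2 q)^-1.
  split; first by rewrite !inv1.
  - move=> k; rewrite -mulrDl normrM normfV (ger0_norm (normr_ge0 (a p + b p))).
    by rewrite ler_pdivrMr ?(lt_le_trans ltr01)// mul1r; exact: (pmax k erefl).
  - move=> k; rewrite -mulrDl normrM normfV (ger0_norm (normr_ge0 (- a q + b q))).
    by rewrite ler_pdivrMr ?(lt_le_trans ltr01)// mul1r; exact: (qmax k erefl).
  have /andP[u0 _] := inv1 _ p1; have /andP[v0 _] := inv1 _ q1.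
  have uv : 1 / 2 <= (s1 p)^-1 * (s2 q)^-1.
    by rewrite -invfM div1r lef_pV2 ?posrE ?mulr_gt0 ?(lt_le_trans ltr01)// ler1n.
  move: u0 v0 uv; set u := (s1 p)^-1; set v := (s2 q)^-1 => u0 v0 uv.
  suff : Num.sqrt 2 <= u + v by lra.
  rewrite -(@ler_pXn2r _ 2)// ?nnegrE ?addr_ge0// sqrt2E.
  by have := sqr_ge0 (u - v); nra.
have [t [t1 ta tb tab]] := same_sign_norm (ale p) (ble p) p1.
have naq : `|- a q| <= 1 by rewrite normrN.
have [t' [t'1 ta' tb' tab']] := same_sign_norm naq (ble q) q1.
(* These are quarter turns of the maximizing points; the common signs place them in the right
   quadrants, and the determinant bounds put them in the section. *)
exists `|b q|, `|- a q|, `|b p|, `|a p|.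
split; first by rewrite !normr_ge0 ?ale ?ble ?naq.
- move=> k; rewrite ta' tb'.
  rewrite (_ : _ + _ = t' * (a k * b q - b k * a q)); last by ring.
  by rewrite normrM t'1 mul1r.
- move=> k; rewrite ta tb.
  rewrite (_ : _ + _ = - t * (a k * b p - b k * a p)); last by ring.
  by rewrite normrM normrN t1 mul1r.
have -> : `|b q| + `|- a q| + (`|b p| + `|a p|) = s1 p + s2 q.
  by rewrite /s1 /s2 tab tab'; ring.
have s0 : 0 <= s1 p + s2 q by apply: addr_ge0; exact: normr_ge0.
rewrite -(@ler_pXn2r _ 2)// ?nnegrE ?mulr_ge0//.
rewrite exprMn sqrt2E.
by have := sqr_ge0 (s1 p - s2 q); nra.
Qed.

Lemma sign_natr_inj (s s' : bool) (i i' : nat) :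
  (0 < i)%N -> (0 < i')%N -> (-1) ^+ s * i%:Z = (-1) ^+ s' * i'%:Z ->
  s = s' /\ i = i'.
Proof. by case: s s' => -[] i0 i'0; rewrite ?expr0 ?expr1 => ?; split=> //; lia. Qed.

Lemma det_mx22 (R : comPzRingType) (X : 'M[R]_2) :
  \det X = X 0 0 * X 1 1 - X 0 1 * X 1 0.
Proof.
rewrite (expand_det_row _ 0) !big_ord_recl big_ord0 /cofactor !det_mx11 !mxE /=.
have -> : lift 0 0 = 1 :> 'I_2 by apply: val_inj.
have -> : lift 1 0 = 0 :> 'I_2 by apply: val_inj.
by rewrite expr0 expr1 mul1r mulN1r mulrN addr0.
Qed.

Lemma facet_det_bound2 (R : realType) : facet_det_bound 2 (Num.sqrt 2 : R).
Proof.
have sqrt2E : Num.sqrt 2 ^+ 2 = 2 :> R by rewrite sqr_sqrtr.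
apply: facet_det_bound_offsets => [|m C f D N fC detC D0 DN]; first by rewrite sqrtr_gt0.
pose a k := C k 0; pose b k := C k 1.
pose pr (k l : 'I_m) (i : 'I_2) := if i == 0 then k else l.
have det_le k l : `|a k * b l - b k * a l| <= 1.
  have := detC (pr k l); rewrite det_mx22 !mxE /pr !eqxx/=.
  by rewrite /a /b; congr (`|_| <= _); ring.
have fCE (i j : 'I_2) : C (f i) j = (i == j)%:R.
  by move: fC => /matrixP/(_ i j); rewrite !mxE.
have a0 : a (f 0) = 1 by rewrite /a fCE.
have b0 : b (f 0) = 0 by rewrite /b fCE.
have a1 : a (f 1) = 0 by rewrite /a fCE.
have b1 : b (f 1) = 1 by rewrite /b fCE.
have ale k : `|a k| <= 1 by have := det_le k (f 1); rewrite a1 b1 mulr1 mulr0 subr0.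
have ble k : `|b k| <= 1.
  by have := det_le k (f 0); rewrite a0 b0 mulr1 mulr0 sub0r normrN.
have nale k : `|- a k| <= 1 by rewrite normrN.
have [g [h [g' [h' [[g01 h01 g'01 h'01] Kg Kg' area]]]]] :=
  octagon_vertices a0 b0 a1 b1 ale ble det_le.
(* The difference of the coefficients of M^2 in N times the number of offsets and in D (2M + 3)^2;
   it is positive because sqrt 2 D < N. *)
pose delta : R := 2 * Num.sqrt 2 * N%:R - 4 * D%:R.
have delta0 : 0 < delta.
  have s2 : 0 < Num.sqrt 2 :> R by rewrite sqrtr_gt0.
  have A0 : 0 < 2 * Num.sqrt 2 :> R by rewrite mulr_gt0.
  move: DN; rewrite -(ltr_pM2l A0).
  by rewrite mulrA -(mulrA 2) -expr2 sqrt2E /delta; lra.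
(* [M] makes [delta] outweigh the lower terms: a loss of 6M in each of four quadrants, and 12M + 9
   <= 21M from (2M + 3)^2. *)
pose M := (Num.truncn ((24 * N%:R + 21 * D%:R) / delta)).+1.
have M1 : 1 <= M%:R :> R by rewrite ler1n.
have Mbig : 24 * N%:R + 21 * D%:R < delta * M%:R.
  by rewrite [delta * _]mulrC -ltr_pdivrMr// /M truncnS_gt.
pose Q1 := quadrant_points a b M; pose Q2 := quadrant_points (fun k => - a k) b M.
(* The boolean selects a point or its opposite, and points of [Q2] have their first coordinate
   negated, so the offsets occupy all four quadrants. *)
pose F : finType := (bool * ({u | u \in Q1} + {u | u \in Q2}))%type.
pose sg (s : bool) (i : nat) : int := (-1) ^+ s * i%:Z.
pose o (u : F) : 'cV[int]_2 := match u.2 with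
  | inl v => \col_j (if j == 0 then sg u.1 (val v).1 else sg u.1 (val v).2)
  | inr v => \col_j (if j == 0 then sg (~~ u.1) (val v).1 else sg u.1 (val v).2)
  end.
(* Two offsets contribute 2 M, and rounding contributes less than 2. *)
exists F, o, (2 * M + 3)%N; split.
- have pos1 (v : {u | u \in Q1}) : (0 < (val v).1)%N /\ (0 < (val v).2)%N.
    by have := valP v; rewrite !inE => /and3P[].
  have pos2 (v : {u | u \in Q2}) : (0 < (val v).1)%N /\ (0 < (val v).2)%N.
    by have := valP v; rewrite !inE => /and3P[].
  have pair_val (i j i' j' : 'I_M.+1) : i = i' :> nat -> j = j' :> nat -> (i, j) = (i', j').
    by move=> /val_inj -> /val_inj ->.
  move=> [s v] [s' v'] /matrixP oE; move: (oE 0 0) (oE 1 0) => {oE}.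
  case: v v' => v [] v'; rewrite /o !mxE /= /sg.
  + have [p1 p2] := pos1 v; have [p1' p2'] := pos1 v'.
    move=> /sign_natr_inj[]// ss' e1 /sign_natr_inj[]// _ e2; rewrite ss'; congr (_, inl _).
    apply: val_inj; rewrite /= (surjective_pairing (sval v)) (surjective_pairing (sval v')).
    exact: pair_val.
  + have [p1 p2] := pos1 v; have [p1' p2'] := pos2 v'.
    by move=> /sign_natr_inj[]// -> _ /sign_natr_inj[]//; case: (s').
  + have [p1 p2] := pos2 v; have [p1' p2'] := pos1 v'.
    by move=> /sign_natr_inj[]// <- _ /sign_natr_inj[]//; case: (s).
  + have [p1 p2] := pos2 v; have [p1' p2'] := pos2 v'.
    move=> /sign_natr_inj[]// /negb_inj ss' e1 /sign_natr_inj[]// _ e2; rewrite ss'; congr (_, inr _).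
    apply: val_inj; rewrite /= (surjective_pairing (sval v)) (surjective_pairing (sval v')).
    exact: pair_val.
- by rewrite addn_gt0.
- rewrite card_prod card_bool card_sum !card_sig.
  have := card_quadrant_points M g01 h01 ale ble Kg.
  have := card_quadrant_points M g'01 h'01 nale ble Kg'.
  rewrite -/Q1 -/Q2 -(ltr_nat R) [X in X < _]natrM natrX !(natrD, natrM).
  set c1 := #|_|%:R; set c2 := #|_|%:R => c2le c1le.
  have N0 : 0 <= N%:R :> R by rewrite ler0n.
  have D1 : 1 <= D%:R :> R by rewrite ler1n.
  have : N%:R * (2 * Num.sqrt 2 * M%:R ^+ 2 - 24 * M%:R) <= N%:R * (2 * (c1 + c2)).
    by rewrite ler_wpM2l//; nra.
  have : (24 * N%:R + 21 * D%:R) * M%:R < delta * M%:R * M%:R.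
    by rewrite ltr_pM2r// (lt_le_trans ltr01).
  by rewrite /delta; nra.
have oM u k : `|a k * (o u 0 0)%:~R + b k * (o u 1 0)%:~R| <= M%:R.
  case: u => s [] v; have := valP v; rewrite !inE => /and3P[_ _ /forallP/(_ k)];
    rewrite /o !mxE /= /sg !rmorphM/= !rmorphXn/= rmorphN1 -!pmulrn.
  + apply: le_trans; rewrite le_eqVlt; apply/orP; left; apply/eqP.
    by rewrite mulrCA [b k * _]mulrCA -mulrDr normrM normrX normrN1 expr1n mul1r.
  + apply: le_trans; rewrite le_eqVlt; apply/orP; left; apply/eqP.
    rewrite mulrCA [b k * _]mulrCA (_ : (-1) ^+ (~~ s) = (-1) ^+ s * -1 :> R).
      rewrite -mulrA -mulrDr normrM normrX normrN1 expr1n mul1r.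
      by congr `|_|; ring.
    by case: s; rewrite ?expr0 ?expr1; ring.
move=> u u' eps k eps1; rewrite !mxE !big_ord_recl big_ord0 !mxE.
have -> : lift 0 0 = 1 :> 'I_2 by apply: val_inj.
rewrite addr0 -/(a k) -/(b k).
have := oM u k; have := oM u' k.
have : `|a k * eps 0 0| < 1 + 0.
  rewrite addr0 normrM (le_lt_trans _ (eps1 0))// ler_piMl//.
have : `|b k * eps 1 0| < 1 + 0.
  rewrite addr0 normrM (le_lt_trans _ (eps1 1))// ler_piMl//.
rewrite !rmorphB/= natrD natrM; set x1 := _%:~R; set x2 := _%:~R; set x3 := _%:~R; set x4 := _%:~R.
have M0 : 0 <= M%:R :> R by rewrite ler0n.
by rewrite !ltr_norml !ler_norml; move=> /andP[? ?] /andP[? ?] /andP[? ?] /andP[? ?]; lra.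
Qed.

(** * Reduction to full dimension *)

(** In a basis [U] of the integer points of the kernel, the problem becomes full-dimensional with
    data [B] and [a]. A determinant found there, times |det T|, is a minor of [alpha] over [A] whose
    rows include [I]; as gcd A_I divides det T, [Delta] bounds it from above. The first alternative
    is [a = 0]. *)
Lemma section_bound (R : realType) m e (I E : {set 'I_m})
    (A : 'M[int]_(m, (#|I| + #|E|) + (1 + e))) (b : 'cV[int]_m)
    (alpha : 'cV[int]_((#|I| + #|E|) + (1 + e))) (kap : R)
    (x : 'cV[R]_((#|I| + #|E|) + (1 + e))) :
  facet_det_bound e kap -> 0 < kap ->
  int_rank A = ((#|I| + #|E|) + (1 + e))%N ->
  (forall z : 'cV[int]_((#|I| + #|E|) + (1 + e)),
     (forall k, (A *m z) k 0 <= b k 0) -> z = 0) ->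
  (forall k, 0 <= b k 0) -> lin_indep_rows A I ->
  row_free (map_mx intr (col_mx (rows A I) (rows A E)) :
    'M[rat]_(_, (#|I| + #|E|) + (1 + e))) ->
  (forall k, (map_mx intr A *m x) k 0 <= (b k 0)%:~R) ->
  map_mx intr (col_mx (rows A I) (rows A E)) *m x = 0 ->
  ((map_mx intr alpha)^T *m x) 0 0 = 0 \/
  ((map_mx intr alpha)^T *m x) 0 0 < kap * Delta R A alpha I.
Proof.
move=> bound kap0 rkA free b_ge0 Ifree IEfree Px Kx.
have [X [T [uX KX]]] := kernel_basis (col_mx (rows A I) (rows A E)).
set AK := col_mx (rows A I) (rows A E) in IEfree Kx KX.
have detT : \det T != 0.
  have : row_free (map_mx intr T : 'M[rat]_(#|I| + #|E|)).
    have uXq : map_mx intr X \in @unitmx rat _ 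
      by rewrite unitmxE unitfE det_map_mx intr_eq0 -absz_gt0 absz_det_unitmx.
    have : \rank (map_mx intr AK *m map_mx intr X : 'M[rat]_(_, _)) = (#|I| + #|E|)%N.
      by rewrite mxrankMfree ?row_free_unit// (eqP IEfree).
    by rewrite -map_mxM KX map_row_mx map_mx0 rank_row_mx0 => rkT; rewrite /row_free rkT.
  by rewrite row_free_unit unitmxE unitfE det_map_mx intr_eq0.
(* [Y] reads off coordinates in the basis [U], and [W] completes [U] to a lattice basis. *)
pose U := rsubmx X; pose W := lsubmx X; pose Y := dsubmx (invmx X).
have XE : X = row_mx W U by rewrite hsubmxK.
have [KW KU] : AK *m W = T /\ AK *m U = 0.
  by apply: eq_row_mx; rewrite -mul_mx_row -XE.
have [_ _ _ YU] : [/\ usubmx (invmx X) *m W = 1%:M, usubmx (invmx X) *m U = 0,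
    Y *m W = 0 & Y *m U = 1%:M].
  by apply/eq_block_mx; rewrite -mul_col_row vsubmxK -XE mulVmx// scalar_mx_block.
pose B := A *m U; pose a := alpha^T *m U; pose y := map_mx intr Y *m x.
have xE : x = map_mx intr U *m y.
  have -> : x = map_mx intr X *m (map_mx intr (invmx X) *m x).
    by rewrite mulmxA -map_mxM mulmxV// map_mx1 mul1mx.
  set v := _ *m x.
  rewrite {1}XE map_row_mx -[v in LHS]vsubmxK mul_row_col.
  have -> : dsubmx v = y by rewrite /v /y -mul_dsub_mx map_dsubmx.
  suff -> : usubmx v = 0 by rewrite mulmx0 add0r.
  have uT : map_mx intr T \in @unitmx R _ by rewrite unitmxE unitfE det_map_mx intr_eq0.
  apply: (can_inj (mulKmx uT)); rewrite mulmx0.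
  have : map_mx intr AK *m map_mx intr X *m v = 0.
    by rewrite /v -mulmxA [map_mx _ X *m _]mulmxA -map_mxM mulmxV// map_mx1 mul1mx.
  rewrite -map_mxM KX map_row_mx map_mx0 -[v in X in X -> _]vsubmxK mul_row_col.
  by rewrite mul0mx addr0.
have ax : (map_mx intr alpha)^T *m x = map_mx intr a *m y.
  by rewrite xE mulmxA map_trmx -map_mxM.
have Bx : map_mx intr B *m y = map_mx intr A *m x.
  by rewrite xE mulmxA -map_mxM.
have [a0|a0] := eqVneq a 0.
  by left; rewrite ax a0 map_mx0 mul0mx mxE.
right.
have Bfull : row_full (map_mx intr B : 'M[rat]_(_, _)).
  have /row_fullP[A' A'A] : row_full (map_mx intr A : 'M[rat]_(_, _)).
    by rewrite /row_full -/(int_rank A) rkA.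
  apply/row_fullP; exists (map_mx intr Y *m A').
  by rewrite map_mxM mulmxA -[_ *m A' *m _]mulmxA A'A mulmx1 -map_mxM YU map_mx1.
have [||f [detf]] := bound _ B b a y Bfull _ b_ge0 a0 _.
- move=> z Bz; rewrite -[z]mul1mx -YU -mulmxA; have -> : U *m z = 0.
    by apply: free => k; rewrite mulmxA.
  by rewrite mulmx0.
- by move=> k; rewrite Bx.
rewrite ax => /lt_le_trans; apply; rewrite ler_pM2l//.
(* The order [I], [E], [alpha], [f] makes the product with [X] block triangular. *)
pose h (k : 'I_((#|I| + #|E|) + (1 + e))) : 'I_(1 + m) :=
  match fintype.split k with
  | inl u => rshift 1 (match fintype.split u with
                       | inl i => enum_val i | inr j => enum_val j end)
  | inr u => match fintype.split u with
             | inl _ => lshift m 0 | inr j => rshift 1 (f j) end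
  end.
have hE : rowsub h (col_mx alpha^T A) = col_mx AK (col_mx alpha^T (rowsub f A)).
  apply/matrixP => i j; rewrite [LHS]mxE /h; case: (split_ordP i) => k ->.
    rewrite col_mxEu col_mxEd /AK; case: (split_ordP k) => l ->.
      by rewrite col_mxEu mxE.
    by rewrite col_mxEd mxE.
  rewrite [RHS]col_mxEd; case: (split_ordP k) => l ->.
    by rewrite !col_mxEu ord1.
  by rewrite !col_mxEd mxE.
have detE : absz (\det (rowsub h (col_mx alpha^T A))) =
    (absz (\det T) * absz (\det (col_mx a (rowsub f B))))%N.
  transitivity (absz (\det (rowsub h (col_mx alpha^T A) *m X))).
    by rewrite det_mulmx abszM (absz_det_unitmx uX) muln1.
  rewrite hE -abszM -(det_lblock T (col_mx alpha^T (rowsub f A) *m W)); congr (absz (\det _)).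
  rewrite XE mul_col_row KW KU; congr block_mx.
  by rewrite mul_col_mx mul_rowsub_mx.
have le_max : (absz (\det (rowsub h (col_mx alpha^T A))) <= max_minor A alpha I)%N.
  apply: leq_max_minor.
  - exists (rshift _ (lshift _ 0)).
    by rewrite /h (unsplitK (inr _)) (unsplitK (inl _)).
  - move=> i iI; exists (lshift _ (lshift _ (enum_rank_in iI i))).
    by rewrite /h !(unsplitK (inl _)) enum_rankK_in.
  - by rewrite -absz_gt0 detE muln_gt0 !absz_gt0 detT.
have gT : (gcd_minors (rows A I) %| absz (\det T))%N.
  by rewrite -KW; apply: gcd_minors_dvd_det; exact/eqP.
have g0 : (0 < gcd_minors (rows A I))%N by rewrite (dvdn_gt0 _ gT)// absz_gt0.
rewrite /Delta ler_pdivlMr ?ltr0n// -natrM ler_nat (leq_trans _ le_max)// detE mulnC.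
by rewrite leq_mul2r (dvdn_leq _ gT) ?orbT// absz_gt0.
Qed.

Local Open Scope classical_set_scope.
Local Open Scope ring_scope.

Lemma row_rowsE (T : Type) m n (A : 'M[T]_(m, n)) (I : {set 'I_m}) i (iI : i \in I) :
  row (enum_rank_in iI i) (rows A I) = row i A.
Proof. by apply/rowP => j; rewrite !mxE enum_rankK_in. Qed.

(** [E] is a largest set of rows vanishing on [S] and independent together with [I]; a further row
    that vanishes on [S] must depend on them. *)
Lemma extend_indep_rows (R : realType) m n (A : 'M[int]_(m, n)) (I : {set 'I_m})
    (S : set 'cV[R]_n) :
  lin_indep_rows A I -> (forall x, S x -> map_mx intr (rows A I) *m x = 0) ->
  exists E : {set 'I_m},
    [/\ row_free (map_mx intr (col_mx (rows A I) (rows A E)) : 'M[rat]_(_, n)),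
        forall x, S x -> map_mx intr (col_mx (rows A I) (rows A E)) *m x = 0 &
        forall i, (row i (map_mx intr A) <=
            (map_mx intr (col_mx (rows A I) (rows A E)) : 'M[rat]_(_, n)))%MS \/
          exists2 x, S x & (map_mx intr A *m x) i 0 != 0].
Proof.
move=> Ifree SI.
pose AK (E : {set 'I_m}) := map_mx intr (col_mx (rows A I) (rows A E)) : 'M[rat]_(#|I| + #|E|, n).
pose vanish i := `[< forall x, S x -> (map_mx intr A *m x) i 0 = 0 >].
pose P (E : {set 'I_m}) := row_free (AK E) && [forall (i | i \in E), vanish i].
have AKE E : AK E = col_mx (map_mx intr (rows A I)) (map_mx intr (rows A E)).
  by rewrite /AK map_col_mx.
have P0 : P finset.set0.
  apply/andP; split; last by apply/forall_inP => i; rewrite inE.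
  have r0 : map_mx intr (rows A finset.set0) = 0 :> 'M[rat]_(_, n).
    by apply/matrixP => -[i i0]; exfalso; move: i0; rewrite cards0.
  rewrite /row_free AKE r0 rank_col_mx0 (eqP Ifree) [X in _ == (_ + X)%N]cards0.
  by rewrite addn0.
have [E /andP[Efree /forall_inP Evan] Emax] := @arg_maxnP _ _ P (fun E => #|E|) P0.
exists E; split=> //.
- move=> x Sx; rewrite map_col_mx mul_col_mx SI//.
  rewrite -[RHS]col_mx0; congr col_mx; apply/matrixP => i j; rewrite ord1.
  have /Evan/asboolP/(_ x Sx) := enum_valP i.
  by move=> /[!mxE] v; rewrite -[RHS]v; apply: eq_bigr => k _; rewrite !mxE.
move=> i; have [?|inK] := boolP (_ <= _)%MS; first by left.
right; apply: contrapT => novan.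
have iE : i \notin E.
  apply: contra inK => iE; rewrite map_col_mx -addsmxE.
  apply: (submx_trans _ (addsmxSr _ _)).
  by rewrite -map_row -(row_rowsE A iE) map_row row_sub.
have vani : vanish i.
  apply/asboolP => x Sx; apply/eqP; apply: contrapT => v.
  by apply: novan; exists x => //; apply/negP.
have /Emax : P (i |: E)%SET.
  apply/andP; split; last first.
    by apply/forall_inP => j; rewrite 2!inE => /orP[/eqP->//|]; exact: Evan.
  rewrite /row_free eqn_leq rank_leq_row /= [X in (_ + X <= _)%N]cardsU1 iE addnCA add1n.
  rewrite -(eqP Efree); apply: (@leq_trans (\rank (AK E + row i (map_mx intr A))%MS)).
    by apply: rank_ltmx; rewrite ltmxE addsmxSl addsmx_sub submx_refl.
  apply: mxrankS; rewrite addsmx_sub; apply/andP; split.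
    rewrite !AKE -!addsmxE; apply: addsmxS; first exact: submx_refl.
    apply/row_subP => k; have kE : enum_val k \in (i |: E)%SET.
      by rewrite inE enum_valP orbT.
    have -> : row k (map_mx intr (rows A E)) =
        row (enum_rank_in kE (enum_val k)) (map_mx intr (rows A (i |: E)%SET))
        :> 'rV[rat]_n.
      by rewrite -!map_row row_rowsE; congr map_mx; apply/rowP => j; rewrite !mxE.
    exact: row_sub.
  rewrite AKE -addsmxE; apply: (submx_trans _ (addsmxSr _ _)).
  by rewrite -map_row -(row_rowsE A (setU11 i E)) map_row row_sub.
by rewrite /geq /= cardsU1 iE add1n ltnn.
Qed.

(** The affine hull of the section is the kernel of [AK]: at a relative interior point every row of
    [A] outside the span of [AK] is slack, so small moves in the kernel stay in the section. Rank
    and nullity give the dimension. *)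
Lemma polyhedron_section_dim (R : realType) m n (A : 'M[int]_(m, n))
    (b : 'cV[int]_m) (I E : {set 'I_m}) (d : nat) :
  let S := polyhedron_section R A b I in
  let AK := col_mx (rows A I) (rows A E) in
  (forall k, 0 <= b k 0) ->
  row_free (map_mx intr AK : 'M[rat]_(_, n)) ->
  (forall x, S x -> map_mx intr AK *m x = 0) ->
  (forall i, (row i (map_mx intr A) <= (map_mx intr AK : 'M[rat]_(_, n)))%MS \/
     exists2 x, S x & (map_mx intr A *m x) i 0 != 0) ->
  has_dim S d -> (#|I| + #|E| + d)%N = n.
Proof.
move=> S AK b_ge0 Kfree SK slack [x0 [V [dimV hullE]]].
have bR k : 0 <= (b k 0)%:~R :> R by rewrite ler0z.
have S0 : S 0.
  by split=> /=; rewrite ?mulmx0// => k; rewrite mulmx0 mxE.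
have Shull x : S x -> affine_hull S x.
  move=> Sx; exists 1%N, (fun=> x), (fun=> 1).
  by split=> //; rewrite big_ord1// scale1r.
have x0V : x0 \in V.
  have := Shull 0 S0; rewrite hullE => -[v /= vV x0v].
  by rewrite -[x0](addrK v) x0v sub0r rpredN.
have hullV v : affine_hull S v <-> v \in V.
  rewrite hullE; split=> [[w /= wV <-]|vV]; first by rewrite rpredD.
  by exists (v - x0); rewrite /= ?rpredB// addrC subrK.
have SV x : S x -> x \in V by move=> Sx; apply/hullV/Shull.
have rowK i (v : 'cV[R]_n) : (row i (map_mx intr A) <=
    (map_mx intr AK : 'M[rat]_(_, n)))%MS -> map_mx intr AK *m v = 0 ->
    (map_mx intr A *m v) i 0 = 0.
  move=> /submxP[D DE] Kv.
  have : (row i (map_mx intr A) : 'rV[R]_n) = map_mx ratr D *m map_mx intr AK.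
    have /(congr1 (map_mx (ratr : rat -> R))) := DE.
    rewrite map_mxM /= => e; transitivity (map_mx ratr (row i (map_mx intr A : 'M[rat]_(m, n))) : 'rV[R]_n).
      by apply/rowP => j; rewrite !mxE ratr_int.
    rewrite e; congr (_ *m _); apply/matrixP => p q; rewrite !mxE ratr_int//.
  move=> rE; have : row i (map_mx intr A) *m v = 0 by rewrite rE -mulmxA Kv mulmx0.
  by rewrite -row_mul => /matrixP/(_ 0 0); rewrite !mxE.
have /fin_all_exists[p pS] : forall i : 'I_m, exists p : 'cV[R]_n, S p /\
   ((row i (map_mx intr A) <= (map_mx intr AK : 'M[rat]_(_, n)))%MS \/
    (map_mx intr A *m p) i 0 < (b i 0)%:~R).
  move=> i; have [?|[x Sx xi]] := slack i; first by exists 0; split=> //; left.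
  (* If [b i 0] is positive, the point 0 is slack at row [i]; if it is zero, a point where row [i]
     does not vanish is slack. *)
  have [/lt_eqF bi|bi] := ltP 0 ((b i 0)%:~R : R); last first.
    exists x; split=> //; right; rewrite lt_neqAle Sx.1 andbT.
    by apply: contra_neq xi => ->; apply/eqP; rewrite eq_le bi bR.
  by exists 0; split=> //; right; rewrite mulmx0 mxE lt_def eq_sym bi bR.
(* The barycenter of 0 and the [p i] is a relative interior point. *)
pose c : R := m.+1%:R^-1.
have c0 : 0 < c by rewrite invr_gt0 ltr0n.
have cm : c * m%:R <= 1 by rewrite mulrC ler_pdivrMr ?ltr0n// mul1r ler_nat.
pose xb := c *: \sum_i p i.
have Axb i : (map_mx intr A *m xb) i 0 = c * \sum_j (map_mx intr A *m p j) i 0.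
  by rewrite -scalemxAr mxE mulmx_sumr summxE.
have Sxb : S xb.
  split=> /= [k|]; last first.
    rewrite -scalemxAr mulmx_sumr big1 ?scaler0// => j _.
    by have [[_ ->] _] := pS j.
  rewrite Axb; apply: (@le_trans _ _ (c * \sum_(j < m) (b k 0)%:~R)).
    by rewrite ler_pM2l//; apply: ler_sum => j _; have [[Pj _] _] := pS j; exact: Pj.
  rewrite sumr_const card_ord -mulr_natl mulrA ler_piMl//.
have xb_slack i : (row i (map_mx intr A) <= (map_mx intr AK : 'M[rat]_(_, n)))%MS \/
    (map_mx intr A *m xb) i 0 < (b i 0)%:~R.
  have [_ [?|pi]] := pS i; [by left|right].
  rewrite Axb; apply: (@lt_le_trans _ _ (c * \sum_(j < m) (b i 0)%:~R)).
    rewrite ltr_pM2l// (bigD1 i)//= [ltRHS](bigD1 i)//= ltr_leD//.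
    by apply: ler_sum => j _; have [[Pj _] _] := pS j; exact: Pj.
  by rewrite sumr_const card_ord -mulr_natl mulrA ler_piMl.
have KV (v : 'cV[R]_n) : map_mx intr AK *m v = 0 -> v \in V.
  move=> Kv.
  (* The sum of all [r i] dominates each of them, so one step length [eps] serves all rows at
     once. *)
  pose r i := `|(map_mx intr A *m v) i 0| / ((b i 0)%:~R - (map_mx intr A *m xb) i 0).
  have r0 i : 0 <= r i by rewrite divr_ge0// subr_ge0 Sxb.1.
  pose eps : R := (1 + \sum_i r i)^-1.
  have sr : 0 < 1 + \sum_i r i by rewrite ltr_pwDl// sumr_ge0.
  have eps0 : 0 < eps by rewrite invr_gt0.
  have Sv : S (xb + eps *: v).
    split=> /= [i|]; last first.
      rewrite mulmxDr Sxb.2 add0r -scalemxAr.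
      have : map_mx intr (rows A I) *m v = 0.
        by move: Kv; rewrite map_col_mx mul_col_mx -[0]col_mx0 => /eq_col_mx[].
      by move=> ->; rewrite scaler0.
    rewrite mulmxDr -[_ *m (eps *: v)]scalemxAr.
    have -> : (map_mx intr A *m xb + eps *: (map_mx intr A *m v)) i 0 =
        (map_mx intr A *m xb) i 0 + eps * (map_mx intr A *m v) i 0 by rewrite !mxE.
    have [iK|lt] := xb_slack i.
      by rewrite (rowK i v iK Kv) mulr0 addr0; exact: Sxb.1.
    have sl : 0 < (b i 0)%:~R - (map_mx intr A *m xb) i 0 by rewrite subr_gt0.
    rewrite addrC -lerBrDr (le_trans (ler_norm _))// normrM gtr0_norm//.
    have -> : `|(map_mx intr A *m v) i 0| =
        r i * ((b i 0)%:~R - (map_mx intr A *m xb) i 0).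
      by rewrite /r divfK// gt_eqF.
    rewrite mulrA ler_piMl ?(ltW sl)// mulrC /eps ler_pdivrMr// mul1r.
    rewrite (bigD1 i)//= ler_wpDl// lerDl sumr_ge0//.
  have -> : v = eps^-1 *: ((xb + eps *: v) - xb).
    by rewrite addrC addKr scalerA mulVf ?scale1r// gt_eqF.
  by rewrite rpredZ// rpredB ?SV.
have VK (v : 'cV[R]_n) : v \in V -> map_mx intr AK *m v = 0.
  move=> /hullV[k [q [t [Sq _ ->]]]]; rewrite mulmx_sumr big1// => j _.
  by rewrite -scalemxAr SK// scaler0.
pose f : 'Hom('cV[R]_n, 'cV[R]_(#|I| + #|E|)) := linfun (mulmx (map_mx intr AK)).
have kerf : lker f = V.
  apply/vspaceP => v; rewrite memv_ker lfunE /=.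
  by apply/eqP/idP => [/KV|/VK].
have imf : limg f = fullv.
  apply/vspaceP => w; rewrite memvf.
  have /row_freeP[Z KZ] : row_free (map_mx intr AK : 'M[R]_(_, n)).
    have -> : map_mx intr AK = map_mx ratr (map_mx intr AK : 'M[rat]_(_, n)) :> 'M[R]_(_, n).
      by apply/matrixP => p' q'; rewrite !mxE ratr_int.
    by rewrite row_free_map.
  have -> : w = f (Z *m w) by rewrite lfunE /= mulmxA KZ mul1mx.
  by rewrite memv_img ?memvf.
have := limg_ker_dim f fullv; rewrite capfv kerf imf dimV !dimvf /dim /= !muln1.
by rewrite addnC.
Qed.

(** * Attainment of the maximum *)

Lemma mulmx_coord_continuous (R : realType) n (c : 'rV[R]_n) :
  continuous (fun u : 'rV[R]_n => (c *m u^T) 0 0).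
Proof.
have -> : (fun u : 'rV[R]_n => (c *m u^T) 0 0) =
    (fun u : 'rV[R]_n => \sum_i c 0 i * u 0 i).
  by apply/funext => u; rewrite mxE; apply: eq_bigr => i _; rewrite mxE.
apply: continuous_big => [|i _ u]; first exact: add_continuous.
apply: (@continuousM _ _ (fun=> c 0 i) (fun u : 'rV[R]_n => u 0 i)).
  exact: cst_continuous.
exact: coord_continuous.
Qed.

(** The bounds for plus and minus the unit vectors make the section bounded; it is also closed,
    hence compact. *)
Lemma polyhedron_section_max (R : realType) m n (A : 'M[int]_(m, n))
    (b : 'cV[int]_m) (I : {set 'I_m}) (alpha : 'cV[int]_n) :
  let S := polyhedron_section R A b I in
  S 0 ->
  (forall beta : 'cV[int]_n, exists C : R,
     forall x, S x -> ((map_mx intr beta)^T *m x) 0 0 <= C) ->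
  exists2 x, S x &
    forall y, S y -> ((map_mx intr alpha)^T *m y) 0 0 <= ((map_mx intr alpha)^T *m x) 0 0.
Proof.
move=> S S0 bnd; pose S' : set 'rV[R]_n := [set u | S u^T].
have S'0 : S' !=set0 by exists 0; rewrite /S' /= trmx0.
have coordE (s : int) i (x : 'cV[R]_n) :
    ((map_mx intr (s *: delta_mx i 0 : 'cV[int]_n))^T *m x) 0 0 = s%:~R * x i 0.
  rewrite mxE (bigD1 i)//= !mxE !eqxx mulr1 big1 ?addr0// => j ji.
  by rewrite !mxE (negPf ji) mulr0 mul0r.
have /fin_all_exists[C CP] : forall i : 'I_n, exists C : R, forall x, S x -> `|x i 0| <= C.
  move=> i; have [C1 C1P] := bnd (1 *: delta_mx i 0); have [C2 C2P] := bnd (-1 *: delta_mx i 0).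
  exists (Num.max C1 C2) => x Sx; rewrite ler_norml lerNl !le_max.
  have := C1P x Sx; have := C2P x Sx; rewrite !coordE mulN1r mul1r => -> ->.
  by rewrite orbT.
have C0 i : 0 <= C i by rewrite (le_trans _ (CP i 0 S0)).
have S'bnd : bounded_set S'.
  exists (\sum_i C i); split=> [|M CM u Su]; first exact: num_real.
  rewrite /= -[leLHS]/(mx_norm u) mx_normrE; apply/bigmax_leP; split.
    by rewrite ltW// (le_lt_trans _ CM)// sumr_ge0.
  move=> [i j] _ /=; rewrite ord1 (le_trans _ (ltW CM))//.
  have := CP j u^T Su; rewrite mxE => /le_trans; apply.
  by rewrite (bigD1 j)//= lerDl sumr_ge0.
have closed_half (c : 'rV[R]_n) (r : R) : closed [set u : 'rV[R]_n | (c *m u^T) 0 0 <= r].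
  apply: (@preimage_closed _ _ _ [set t : R | t <= r]); last exact: closed_le.
  by move=> u _; exact: mulmx_coord_continuous.
have closed_hyper (c : 'rV[R]_n) : closed [set u : 'rV[R]_n | (c *m u^T) 0 0 = 0].
  apply: (@preimage_closed _ _ _ [set t : R | t = 0]); last exact: closed_eq.
  by move=> u _; exact: mulmx_coord_continuous.
have S'cl : closed S'.
  have -> : S' =
      (\bigcap_(k in [set: 'I_m]) [set u : 'rV[R]_n |
          (row k (map_mx intr A) *m u^T) 0 0 <= (b k 0)%:~R]) `&`
      (\bigcap_(k in [set: 'I_#|I|]) [set u : 'rV[R]_n |
          (row k (map_mx intr (rows A I)) *m u^T) 0 0 = 0]).
    apply/seteqP; split=> u /= [uP uI]; split.
    - by move=> k _; rewrite /= -row_mul mxE; exact: uP.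
    - by move=> k _; rewrite /= -row_mul mxE uI mxE.
    - by move=> k; have := uP k Logic.I; rewrite /= -row_mul mxE.
    - apply/matrixP => k j; rewrite ord1 [RHS]mxE.
      by have := uI k Logic.I; rewrite /= -row_mul mxE.
  by apply: closedI; apply: closed_bigI.
have cont : {within S', continuous (fun u : 'rV[R]_n => ((map_mx intr alpha)^T *m u^T) 0 0)}.
  by apply: continuous_subspaceT; exact: mulmx_coord_continuous.
have [u uS umax] := compact_EVT_max S'0 (bounded_closed_compact S'bnd S'cl) cont.
exists u^T; first exact: set_mem uS.
by move=> y Sy; have := umax y^T; rewrite trmxK; apply; apply/mem_set; rewrite /S' /= trmxK.
Qed.

(** The pointwise bound [pw] holds for every objective, so the section is compact and the strict
    bound passes to the attained maximum. *)
Lemma kappa_lt (R : realType) m n (A : 'M[int]_(m, n)) (b : 'cV[int]_m)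
    (alpha : 'cV[int]_n) (I : {set 'I_m}) (e : nat) (kap : R) :
  facet_det_bound e kap -> 0 < kap -> int_rank A = n ->
  polyhedron R A b `&` int_points R n = [set 0] ->
  lin_indep_rows A I -> has_dim (polyhedron_section R A b I) (1 + e) ->
  (kappa R A b alpha I < kap%:E)%E.
Proof.
move=> bound kap0 rkA latfree Ifree Idim.
have intP (z : 'cV[int]_n) k : (map_mx intr A *m map_mx intr z : 'cV[R]_m) k 0 = ((A *m z) k 0)%:~R.
  by rewrite -map_mxM mxE.
have b_ge0 k : 0 <= b k 0.
  have : (polyhedron R A b `&` int_points R n) 0 by rewrite latfree.
  by move=> -[/(_ k)]; rewrite mulmx0 mxE ler0z.
have free (z : 'cV[int]_n) : (forall k, (A *m z) k 0 <= b k 0) -> z = 0.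
  move=> Az; have : (polyhedron R A b `&` int_points R n) (map_mx intr z).
    by split; [move=> k; rewrite intP ler_int|exists z].
  rewrite latfree /= => /matrixP z0; apply/matrixP => i j.
  by have := z0 i j; rewrite !mxE => /eqP; rewrite intr_eq0 => /eqP.
set S := polyhedron_section R A b I in Idim *.
have S0 : S 0 by split=> /= [k|]; rewrite mulmx0// mxE ler0z.
have [E [Efree SE Emax]] := @extend_indep_rows R m n A I S Ifree (fun x Sx => Sx.2).
have nE := polyhedron_section_dim b_ge0 Efree SE Emax Idim.
have pw beta x : S x -> ((map_mx intr beta)^T *m x) 0 0 = 0 \/
    ((map_mx intr beta)^T *m x) 0 0 < kap * Delta R A beta I.
  move=> Sx; have Kx := SE x Sx; have Px := Sx.1.
  (* Everything whose type mentions [n] is generalized so that [nE] can replace [n] by the sum. *)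
  move: beta x {latfree Idim S0 SE Emax Sx} Kx Px.
  move: {S} A alpha rkA Ifree Efree free {intP}.
  case: n / nE => A alpha rkA Ifree Efree free beta x Kx Px.
  exact: (@section_bound R m e I E A b beta kap x).
have Delta_ge0 beta : 0 <= Delta R A beta I by rewrite /Delta divr_ge0.
have [|x Sx xmax] := @polyhedron_section_max R m n A b I alpha S0.
  move=> beta; exists (kap * Delta R A beta I) => x Sx.
  by have [->|/ltW//] := pw beta x Sx; rewrite mulr_ge0// ltW.
rewrite /kappa; case: ifPn => [_|D0]; first by rewrite lte_fin.
have Dp : 0 < Delta R A alpha I by rewrite lt_def D0 Delta_ge0.
apply: (@le_lt_trans _ _ (((map_mx intr alpha)^T *m x) 0 0 / Delta R A alpha I)%:E).
  rewrite EFinM; apply: lee_wpmul2r; first by rewrite lee_fin invr_ge0.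
  by apply: ge_ereal_sup => _ [y Sy <-]; rewrite lee_fin; exact: xmax.
rewrite lte_fin ltr_pdivrMr//.
by have [->|//] := pw alpha x Sx; rewrite mulr_gt0.
Qed.

(** There are finitely many [I], so the supremum is at most a finite maximum and strictness
    survives; with no [I] it is [-oo]. *)
Lemma kappa_dim_lt (R : realType) m n (A : 'M[int]_(m, n)) (b : 'cV[int]_m)
    (alpha : 'cV[int]_n) (e : nat) (kap : R) :
  facet_det_bound e kap -> 0 < kap -> int_rank A = n ->
  polyhedron R A b `&` int_points R n = [set 0] ->
  (kappa_dim R A b alpha (1 + e) < kap%:E)%E.
Proof.
move=> bound kap0 rkA latfree.
pose Q (I : {set 'I_m}) := `[< [/\ lin_indep_rows A I, (#|I| < n)%N
   & has_dim (polyhedron_section R A b I) (1 + e)] >].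
apply: (@le_lt_trans _ _
  (\big[Order.max/-oo%E]_(I : {set 'I_m} | Q I) kappa R A b alpha I)).
  apply: ge_ereal_sup => _ [I IQ <-].
  by apply: (bigmax_sup I) => //; apply/asboolP.
apply/bigmax_ltP; split; first exact: ltNyr.
by move=> I /asboolP[Ifree _ Idim]; exact: (kappa_lt _ bound).
Qed.

Theorem theorem4 (R : realType) (m n : nat) (A : 'M[int]_(m, n))
    (b : 'cV[int]_m) (alpha : 'cV[int]_n)
    (A_full_column_rank : int_rank A = n)
    (lattice_free : polyhedron R A b `&` int_points R n = [set 0]) :
  [/\ (kappa_dim R A b alpha 1 < 1)%E,
      (kappa_dim R A b alpha 2 < 1)%E
    & (kappa_dim R A b alpha 3 < (Num.sqrt 2)%:E)%E].
Proof.
split.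
- exact: (kappa_dim_lt alpha (@facet_det_bound0 R) ltr01 A_full_column_rank lattice_free).
- exact: (kappa_dim_lt alpha (@facet_det_bound1 R) ltr01 A_full_column_rank lattice_free).
- apply: (kappa_dim_lt alpha (@facet_det_bound2 R) _ A_full_column_rank lattice_free).
  by rewrite sqrtr_gt0.
Qed.
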